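(* Let $b,p,q$ be positive integers such that $q$ does not divide $bp$ and $q^2 \geq b$. Then for all $p \geq b+q-1$, the $\mathrm{LS}_+$-rank of $b\text{-}\mathrm{MT}(K_p^q)$ is at least $\lfloor \frac{p-b-q+1}{2q} \rfloor + 1$.
   Context: $K_p^q$ is the complete $q$-uniform hypergraph on vertex set $[p]$. For a $q$-uniform hypergraph $G$ and positive integer $b$, $b\text{-}\mathrm{MT}(G) := \{x\in[0,1]^{E(G)} : \sum_{S\in E(G),\ S\ni i} x_S \le b\ \forall i\in V(G)\}$. For $P\subseteq[0,1]^n$: $P_I := \mathrm{conv}(P\cap\{0,1\}^n)$; $K(P) := \{(\lambda,\lambda x):\lambda\ge0,x\in P\}$; $\mathrm{LS}_+(P)$ is the set of $x$ for which there is a symmetric $(n+1)\times(n+1)$ matrix $Y$ (indexed by $0,\dots,n$) with $Ye_0=\mathrm{diag}(Y)=(1,x)$, $Ye_i, Y(e_0-e_i)\in K(P)$ for all $i\in[n]$, and $Y\succeq0$. The $\mathrm{LS}_+$-rank of $P$ is the smallest $k$ with $\mathrm{LS}_+^k(P)=P_I$, where $\mathrm{LS}_+^k$ is $k$-fold iteration. *)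

(* Defs.v *)
From HB Require Import structures.
From mathcomp Require Import all_boot all_order all_algebra.
From mathcomp Require Import mathcomp_extra boolp classical_sets reals.
From mathcomp Require Import interval_inference convex.
From mathcomp Require Import ring lra.

Set Implicit Arguments.
Unset Strict Implicit.
Unset Printing Implicit Defensive.

Import Order.TTheory GRing.Theory Num.Theory.

Local Open Scope classical_set_scope.
Local Open Scope ring_scope.

Section LovaszSchrijver.
Context {R : realType} {n : nat}.
Local Notation convex := (@convex_set R 'cV[R]_n).
Implicit Types P Q : set 'cV[R]_n.

Definition cube : set 'cV[R]_n := [set x | forall i, 0 <= x i 0 <= 1].

Definition cube01 : set 'cV[R]_n := [set x | forall i, x i 0 = 0 \/ x i 0 = 1].

Definition convex_hull P : set 'cV[R]_n := smallest convex P.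

Definition integer_hull P : set 'cV[R]_n := convex_hull (P `&` cube01).

(* R^{n+1} with coordinates 0, ..., n is 'cV_(1 + n); [hvec l x] is (l, x). *)
Definition hvec (l : R) (x : 'cV[R]_n) : 'cV[R]_(1 + n) := col_mx l%:M x.

Definition e0 : 'cV[R]_(1 + n) := delta_mx (lshift n 0) 0.

Definition e_ (i : 'I_n) : 'cV[R]_(1 + n) := delta_mx (rshift 1 i) 0.

Definition Kcone P : set 'cV[R]_(1 + n) :=
  [set y | exists l x, [/\ 0 <= l, P x & y = hvec l (l *: x)]].

Definition psd m (A : 'M[R]_m) : Prop :=
  forall v : 'cV[R]_m, 0 <= (v^T *m A *m v) 0 0.

Definition LSp P : set 'cV[R]_n :=
  [set x | exists Y : 'M[R]_(1 + n),
    [/\ Y^T = Y,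
        Y *m e0 = hvec 1 x /\ \col_i Y i i = hvec 1 x,
        forall i, Kcone P (Y *m e_ i) /\ Kcone P (Y *m (e0 - e_ i)) &
        psd Y]].

Definition LSp_iter (k : nat) P : set 'cV[R]_n := iter k LSp P.

Definition LSp_exact P : pred nat :=
  fun k => `[< LSp_iter k P = integer_hull P >].

(* The default value 0 is not used for convex P contained in [0,1]^n: see
   [LSp_rankP]. *)
Definition LSp_rank P : nat :=
  if pselect (exists k, LSp_exact P k) is left ex then ex_minn ex else 0%N.

Lemma convex_setP Q : convex Q <->
  forall x y t, 0 <= t -> t <= 1 -> Q x -> Q y -> Q (t *: x + (1 - t) *: y).
Proof.
split=> [cQ x y t t0 t1 Qx Qy|cQ x y t].
  by have := cQ x y (Itv01 t0 t1); rewrite !inE; apply.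
by rewrite !inE => Qx Qy; apply: cQ.
Qed.

Lemma convex_setI_bigcap (F : set (set 'cV[R]_n)) :
  (forall Q, F Q -> convex Q) ->
  convex (\bigcap_(Q in F) Q).
Proof.
move=> cF; apply/convex_setP => x y t t0 t1 Fx Fy Q FQ.
by move/convex_setP: (cF _ FQ); apply=> //; [exact: Fx|exact: Fy].
Qed.

Lemma convex_convex_hull P : convex (convex_hull P).
Proof. by apply: convex_setI_bigcap => Q []. Qed.

Lemma hvecD l m x y : hvec l x + hvec m y = hvec (l + m) (x + y).
Proof. by rewrite /hvec add_col_mx raddfD. Qed.

Lemma hvecZ a l x : a *: hvec l x = hvec (a * l) (a *: x).
Proof. by rewrite /hvec scale_col_mx scale_scalar_mx. Qed.

Lemma hvec_inj l m x y : hvec l x = hvec m y -> l = m /\ x = y.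
Proof.
move/eq_col_mx => [/matrixP/(_ 0 0)]; by rewrite !mxE eqxx !mulr1n.
Qed.

Lemma KconeZ P a y : 0 <= a -> Kcone P y -> Kcone P (a *: y).
Proof.
move=> a0 [l [x [l0 Px ->]]]; exists (a * l), x; split=> //.
  exact: mulr_ge0.
by rewrite hvecZ scalerA.
Qed.

Lemma KconeD P y z : convex P ->
  Kcone P y -> Kcone P z -> Kcone P (y + z).
Proof.
move=> /convex_setP cP [l [u [l0 Pu ->]]] [m [v [m0 Pv ->]]].
have [lm0|lm0] := eqVneq (l + m) 0.
  have [-> ->] : l = 0 /\ m = 0 by split; lra.
  by exists 0, u; rewrite hvecD addr0 !scale0r addr0.
have lm : 0 < l + m by rewrite lt_neqAle eq_sym lm0 addr_ge0.
exists (l + m), ((l / (l + m)) *: u + (1 - l / (l + m)) *: v); split.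
- exact: ltW.
- apply: cP => //; first by rewrite divr_ge0 // ltW.
  by rewrite ler_pdivrMr // mul1r lerDl.
- rewrite hvecD scalerDr !scalerA; congr (hvec _ (_ *: _ + _ *: _)); by field.
Qed.

(* The weights that a certificate matrix Y gives to its columns Y e_i and
   Y (e_0 - e_i) are x_i and 1 - x_i. *)
Lemma LSp_split P x i : LSp P x -> exists u v,
  [/\ P u /\ P v, 0 <= x i 0 <= 1, x = x i 0 *: u + (1 - x i 0) *: v,
      x i 0 * u i 0 = x i 0 & (1 - x i 0) * v i 0 = 0].
Proof.
case=> Y [Ys [Y0 Yd] /(_ i) [[l [u [l0 Pu Yi]]] [m [v [m0 Pv Yj]]]] _].
have xE : x i 0 = Y (rshift 1 i) (lshift n 0).
  have /matrixP/(_ (rshift 1 i) 0) := Y0.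
  by rewrite -colE col_mxEd mxE => <-.
have dE : x i 0 = Y (rshift 1 i) (rshift 1 i).
  by have /matrixP/(_ (rshift 1 i) 0) := Yd; rewrite col_mxEd mxE.
have lE : l = x i 0.
  have /matrixP/(_ (lshift n 0) 0) := Yi; rewrite -colE col_mxEu !mxE eqxx mulr1n => <-.
  by rewrite xE -{1}Ys mxE.
have uE : x i 0 * u i 0 = x i 0.
  have /matrixP/(_ (rshift 1 i) 0) := Yi; rewrite -colE col_mxEd !mxE -dE.
  by rewrite lE.
have YB : Y *m e0 = Y *m e_ i + Y *m (e0 - e_ i) by rewrite -mulmxDr addrC subrK.
move: YB; rewrite Y0 Yi Yj hvecD => /hvec_inj [lm xs].
have mE : m = 1 - x i 0 by rewrite -lE lm addrC addKr.
exists u, v; split=> //.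
- by rewrite -{1}lE l0 /= -subr_ge0 -mE.
- by rewrite -mE -lE.
- have /matrixP/(_ i 0) := xs; rewrite !mxE -mE lE uE.
  by move=> xi; apply: (@addrI _ (x i 0)); rewrite addr0 -xi.
Qed.

Lemma LSp_cube P : LSp P `<=` cube.
Proof. by move=> x Px i; have [u [v []]] := LSp_split i Px. Qed.

Lemma convex_LSp P : convex P -> convex (LSp P).
Proof.
move=> cP; apply/convex_setP => x y t t0 t1.
move=> [Y [Ys [Y0 Yd] YK Yp]] [Z [Zs [Z0 Zd] ZK Zp]].
have s0 : 0 <= 1 - t by rewrite subr_ge0.
have tE w : (t *: Y + (1 - t) *: Z) *m w = t *: (Y *m w) + (1 - t) *: (Z *m w).
  by rewrite mulmxDl -!scalemxAl.
have hE : t *: hvec 1 x + (1 - t) *: hvec 1 y =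
    hvec 1 (t *: x + (1 - t) *: y).
  by rewrite !hvecZ hvecD !mulr1 addrC subrK.
exists (t *: Y + (1 - t) *: Z); split.
- by rewrite linearD /= !linearZ /= Ys Zs.
- split; first by rewrite tE Y0 Z0.
  by rewrite -hE -Yd -Zd; apply/matrixP => j k; rewrite !mxE.
- move=> i; have [Y1 Y2] := YK i; have [Z1 Z2] := ZK i.
  by rewrite !tE; split; apply: KconeD => //; apply: KconeZ.
- move=> v; rewrite -mulmxA tE mulmxDr -!scalemxAr !mulmxA mxE.
  by rewrite addr_ge0 // mxE mulr_ge0 // ?Yp ?Zp.
Qed.

Lemma cube01_LSp P : P `&` cube01 `<=` LSp P.
Proof.
move=> x [Px x01]; pose h := hvec 1 x.
have hM j : h *m h^T *m delta_mx j 0 = h j 0 *: h.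
  by rewrite -mulmxA -colE; apply/matrixP => a b;
    rewrite mxE big_ord1 !mxE !ord1 mulrC.
have h0 : h (lshift n 0) 0 = 1 by rewrite /h /hvec col_mxEu mxE eqxx.
have hi i : h (rshift 1 i) 0 = x i 0 by rewrite /h /hvec col_mxEd.
have KP l : 0 <= l -> Kcone P (l *: h).
  by move=> l0; exists l, x; rewrite /h hvecZ mulr1.
exists (h *m h^T); split.
- by rewrite trmx_mul trmxK.
- split; first by rewrite hM h0 scale1r.
  apply/matrixP => j k; rewrite ord1 -/h mxE mxE big_ord1 [h^T _ _]mxE.
  case: (split_ordP j) => i ->.
    by rewrite ord1 h0 mulr1.
  by rewrite hi; case: (x01 i) => ->; rewrite ?mulr0 ?mulr1.
- move=> i; rewrite mulmxBr /e0 /e_ !hM h0 hi -scalerBl.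
  by split; apply: KP; case: (x01 i) => ->; lra.
- move=> v; rewrite mulmxA -mulmxA -[h^T *m v]trmxK trmx_mul trmxK.
  by rewrite mxE big_ord1 !mxE -expr2 sqr_ge0.
Qed.

Lemma LSp_iter_sub k P : (k <= n)%N -> P `<=` cube -> LSp_iter k P `<=`
  convex_hull (P `&` [set y | forall i : 'I_n, (i < k)%N ->
                              y i 0 = 0 \/ y i 0 = 1]).
Proof.
elim: k P => [|k IH] P kn Pc.
  by move=> x Px; apply: sub_gen_smallest; split.
rewrite /LSp_iter iterSr => x /(IH _ (ltnW kn) (@LSp_cube P)).
apply: smallest_sub; first exact: convex_convex_hull.
move=> {}x [LPx xk].
pose i := Ordinal kn.
have [u [v [[Pu Pv] /andP[x0 x1] xE uE vE]]] := LSp_split i LPx.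
set H := convex_hull _.
have HP y : P y -> (forall j : 'I_n, (j < k)%N -> y j 0 = 0 \/ y j 0 = 1) ->
    y i 0 = 0 \/ y i 0 = 1 -> H y.
  move=> Py yk yi; apply: sub_gen_smallest; split=> // j.
  rewrite ltnS leq_eqVlt => /orP[/eqP jk|]; last exact: yk.
  by rewrite (_ : j = i) //; apply: val_inj.
have [xi0|xi0] := eqVneq (x i 0) 0.
  by move: xE; rewrite xi0 scale0r add0r subr0 scale1r => xv;
    apply: HP => //; [rewrite xv|left].
have [xi1|xi1] := eqVneq (x i 0) 1.
  by move: xE; rewrite xi1 subrr scale0r scale1r addr0 => xu;
    apply: HP => //; [rewrite xu|right].
have {}x0 : 0 < x i 0 by rewrite lt_neqAle eq_sym xi0.
have {}x1 : 0 < 1 - x i 0 by rewrite subr_gt0 lt_neqAle xi1.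
have uv (j : 'I_n) : (j < k)%N -> u j 0 = x j 0 /\ v j 0 = x j 0.
  move=> /xk; have /andP[u0 u1] := Pc _ Pu j; have /andP[v0 v1] := Pc _ Pv j.
  have /matrixP/(_ j 0) := xE; rewrite !mxE => xjE.
  by case=> xj; move: xjE; rewrite xj => xjE; split; nra.
rewrite xE; have /convex_setP := @convex_convex_hull
  (P `&` [set y | forall i : 'I_n, (i < k.+1)%N -> y i 0 = 0 \/ y i 0 = 1]).
apply; [exact: ltW|by rewrite -subr_ge0 ltW|apply: HP => //|apply: HP => //].
- by move=> j jk; have [-> _] := uv j jk; exact: xk.
- by right; apply: (mulfI xi0); rewrite mulr1.
- by move=> j jk; have [_ ->] := uv j jk; exact: xk.
- by left; apply/eqP; move/eqP: vE; rewrite mulf_eq0 gt_eqF.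
Qed.

Lemma LSp_exact_ex P : convex P -> P `<=` cube ->
  exists k, LSp_exact P k.
Proof.
move=> cP Pc; exists n; apply/asboolP/seteqP; split.
  apply: subset_trans (LSp_iter_sub (leqnn n) Pc) _.
  by apply: smallest_sub; [exact: convex_convex_hull|];
    move=> x [Px xn]; apply: sub_gen_smallest; split=> // i; exact: xn.
have H k : convex (LSp_iter k P) /\ P `&` cube01 `<=` LSp_iter k P.
  elim: k => [|k [cK sK]]; first by split=> // x [].
  split; first exact: convex_LSp.
  by move=> x [Px x01]; apply: cube01_LSp; split=> //; apply: sK.
by have [] := H n; exact: smallest_sub.
Qed.

Lemma LSp_rankP P : convex P -> P `<=` cube ->
  LSp_iter (LSp_rank P) P = integer_hull P /\
  forall k, LSp_iter k P = integer_hull P -> (LSp_rank P <= k)%N.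
Proof.
move=> cP Pc; rewrite /LSp_rank; case: pselect => [ex|]; last first.
  by have := LSp_exact_ex cP Pc.
case: ex_minnP => r /asboolP rE rmin; split=> // k /asboolP.
exact: rmin.
Qed.

End LovaszSchrijver.

(* Coordinates are the edges of the hypergraph (V, E), numbered by enum_val. *)
Definition bMT {R : realType} {V : finType} (b : nat) (E : {set {set V}}) :
    set 'cV[R]_#|E| :=
  [set x | cube x /\
    forall i : V, \sum_(j < #|E| | i \in (enum_val j : {set V})) x j 0 <= b%:R].

Arguments bMT {R V} b E _.

Definition complete_hypergraph (p q : nat) : {set {set 'I_p}} :=
  [set S : {set 'I_p} | #|S| == q].

Lemma bMT_cube {R : realType} {V : finType} (b : nat) (E : {set {set V}}) :
  @bMT R V b E `<=` cube.
Proof. by move=> x []. Qed.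

Lemma convex_bMT {R : realType} {V : finType} (b : nat) (E : {set {set V}}) :
  @convex_set R 'cV[R]_#|E| (bMT b E).
Proof.
apply/convex_setP => x y t t0 t1 [x01 xb] [y01 yb].
have s0 : 0 <= 1 - t by rewrite subr_ge0.
split=> [j|i].
  have /andP[? ?] := x01 j; have /andP[? ?] := y01 j; rewrite !mxE.
  by apply/andP; split; nra.
under eq_bigr do rewrite !mxE.
rewrite big_split -!mulr_sumr /= (_ : b%:R = t * b%:R + (1 - t) * b%:R); last ring.
by rewrite lerD // ler_wpM2l.
Qed.

(* Main.v *)
Require Import Defs.
From mathcomp Require Import all_boot all_order all_algebra.
From mathcomp Require Import reals.
From mathcomp Require Import perm convex ring lra zify.
From mathcomp Require boolp classical_sets topology normedtype derive.

Set Implicit Arguments.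
Unset Strict Implicit.
Unset Printing Implicit Defensive.

Import Order.TTheory GRing.Theory Num.Theory.

(* The uniform point of weight c = b / C(p - 1, q - 1) makes every degree
   constraint tight and has total weight bp/q, which is not an integer, so it
   is not in the integer hull. It survives k rounds when p >= b + q - 1 + 2qk;
   the induction carries the more general points that are 0/1 on the edges not
   inside a vertex set U and uniform on the edges inside U.

   One round removes a random 2q-set W of U on which a b-regular family of
   q-sets is chosen, all edges crossing W being rejected; what remains is
   uniform on U \ W. Take W through a fixed vertex i. For every edge S through
   i the coordinate S of the resulting point is 0 or 1, the mean is the uniform
   point, and the mean conditional on S does not depend on i in S. These
   conditional means are the columns of the certificate matrix, and both cone
   conditions hold. Semidefiniteness reduces to the Hoffman bound on the least
   eigenvalue of the Kneser graph of the 2q-subsets of U, which requires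
   |U| >= 4q. In the last round |U| may be smaller, but there the columns only
   have to lie in the polytope itself, and a mixture of the normalised Kneser
   matrix of the q-subsets with the all-ones matrix does it. *)

(** * Least values of quadratic forms on the unit sphere *)

Section SymmetricForm.
Import boolp classical_sets topology normedtype derive.
Import numFieldNormedType.Exports.
Local Open Scope ring_scope.

Lemma continuous_sum {R : realType} {S : topologicalType} (I : Type)
    (r : seq I) (f : I -> S -> R) :
  (forall i, continuous (f i)) -> continuous (fun x => \sum_(i <- r) f i x).
Proof.
move=> cf; elim: r => [|i r IH] x.
  by under eq_fun do rewrite big_nil; exact: cvg_cst.
by under eq_fun do rewrite big_cons; apply: cvgD; [exact: cf|exact: IH].
Qed.

Context {R : realType} {T : finType}.
Implicit Types (A : T -> T -> R) (u v : T -> R).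

Definition qform A v := \sum_s \sum_t A s t * (v s * v t).

Lemma qform_line A u v (e : R) : (forall s t, A s t = A t s) ->
  qform A (fun t => u t + e * v t) =
  qform A u + e *+ 2 * (\sum_s v s * \sum_t A s t * u t) + e ^+ 2 * qform A v.
Proof.
move=> As.
have H1 : \sum_s \sum_t A s t * (u s * v t) = \sum_s v s * \sum_t A s t * u t.
  rewrite exchange_big /=; apply: eq_bigr => s _; rewrite mulr_sumr.
  by apply: eq_bigr => t _; rewrite As; ring.
have H2 : \sum_s \sum_t A s t * (v s * u t) = \sum_s v s * \sum_t A s t * u t.
  apply: eq_bigr => s _; rewrite mulr_sumr.
  by apply: eq_bigr => t _; ring.
rewrite mulrnAl mulr2n -{1}H1 -H2 /qform !mulr_sumr -!big_split /=.
apply: eq_bigr => s _; rewrite !mulr_sumr -!big_split /=.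
by apply: eq_bigr => t _; ring.
Qed.

Lemma qformZ A v (a : R) : qform A (fun t => a * v t) = a ^+ 2 * qform A v.
Proof.
rewrite /qform mulr_sumr; apply: eq_bigr => s _.
by rewrite mulr_sumr; apply: eq_bigr => t _; ring.
Qed.

Lemma sum_sqr_eq0 v : \sum_t v t ^+ 2 = 0 -> forall t, v t = 0.
Proof.
move=> v0 t; apply/eqP; rewrite -sqrf_eq0; apply/eqP.
by apply: (psumr_eq0P _ v0) => // s _; exact: sqr_ge0.
Qed.

(** Extreme value theorem on the sphere, transported to row vectors by the enumeration of [T]. The
    element [t0] makes the sphere nonempty. *)
Lemma qform_sphere_min A (t0 : T) : exists u,
  \sum_t u t ^+ 2 = 1 /\
  forall v, \sum_t v t ^+ 2 = 1 -> qform A u <= qform A v.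
Proof.
pose F (w : 'rV[R]_#|T|) (t : T) : R := w 0 (enum_rank t).
pose K := [set w : 'rV[R]_#|T| | \sum_t F w t ^+ 2 = 1]%classic.
have cF t : continuous (fun w => F w t) by exact: coord_continuous.
have cN : continuous (fun w => \sum_t F w t ^+ 2).
  apply: continuous_sum => t w; have cw := cF t w.
  exact: (continuousM cw cw).
have cQ : continuous (fun w => qform A (F w)).
  apply: continuous_sum => s; apply: continuous_sum => t w.
  have cs := cF s w; have ct := cF t w.
  have ca : {for w, continuous (fun=> A s t : R)} by exact: cst_continuous.
  exact: (continuousM ca (continuousM cs ct)).
have FE v : F (\row_j v (enum_val j)) =1 v.
  by move=> t; rewrite /F mxE enum_rankK.
have Kn : (K !=set0)%classic.
  exists (\row_j (enum_val j == t0)%:R); rewrite /K /=.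
  under eq_bigr do rewrite (FE (fun t => (t == t0)%:R)).
  rewrite (bigD1 t0) //= eqxx expr1n big1 ?addr0 // => t /negPf ->.
  by rewrite expr0n.
have cK : compact K.
  apply: bounded_closed_compact.
    (* The norm of a row vector is the maximum norm, and each squared coordinate is at most the sum
       of all squares, which is 1. *)
    exists 1; split=> // M M1 w /= wK.
    rewrite [leLHS]/Num.norm /= mx_normrE; apply: bigmax_le => [|[i j] _ /=].
      by apply: ltW; apply: lt_trans M1.
    rewrite ord1; apply: le_trans (ltW M1).
    rewrite -(@expr_le1 _ 2) // real_normK ?num_real // -wK.
    rewrite (bigD1 (enum_val j)) //= /F enum_valK lerDl.
    by apply: sumr_ge0 => t _; exact: sqr_ge0.
  apply: (preimage_closed (D := [set x : R | x = 1]%classic)) => [x _|].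
    exact: cN.
  exact: closed_eq.
have [w wK wmin] := EVT_min_rV Kn cK (continuous_subspaceT cQ).
rewrite inE in wK.
exists (F w); split=> // v v1.
have := wmin (\row_j v (enum_val j)); rewrite inE /K /=.
have -> : \sum_t F (\row_j v (enum_val j)) t ^+ 2 = 1.
  by rewrite -v1; apply: eq_bigr => t _; rewrite FE.
move=> /(_ erefl) /le_trans; apply.
rewrite le_eqVlt; apply/orP; left; apply/eqP.
by apply: eq_bigr => s _; apply: eq_bigr => t _; rewrite !FE.
Qed.

(* A minimiser of the form on the unit sphere is an eigenvector, so it is
   enough to bound the eigenvalues. *)
Lemma qform_ge A (mu : R) : (forall s t, A s t = A t s) ->
  (forall u l, l < - mu -> (forall s, \sum_t A s t * u t = l * u s) ->
     forall s, u s = 0) ->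
  forall v, - mu * \sum_t v t ^+ 2 <= qform A v.
Proof.
move=> As eig v.
have [/card0_eq T0|/card_gt0P [t0 _]] := posnP #|T|.
  by rewrite /qform !big_pred0 ?mulr0 // => t; have := T0 t.
have [u [u1 umin]] := qform_sphere_min A t0.
set l := qform A u in umin.
have lmin w : l * \sum_t w t ^+ 2 <= qform A w.
  have [w0|w0] := eqVneq (\sum_t w t ^+ 2) 0.
    rewrite w0 mulr0 /qform big1 // => s _; rewrite big1 // => t _.
    by rewrite (sum_sqr_eq0 w0 s) mul0r mulr0.
  have {w0}w_gt0 : 0 < \sum_t w t ^+ 2.
    by rewrite lt_neqAle eq_sym w0 sumr_ge0 // => t _; exact: sqr_ge0.
  set N := \sum_t w t ^+ 2 in w_gt0 *.
  have sE : (Num.sqrt N)^-1 ^+ 2 = N^-1 by rewrite exprVn sqr_sqrtr // ltW.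
  have := umin (fun t => (Num.sqrt N)^-1 * w t); rewrite qformZ sE.
  under eq_bigr do rewrite exprMn sE.
  rewrite -mulr_sumr mulVf ?gt_eqF // => /(_ erefl).
  by rewrite mulrC ler_pdivlMr.
have ueig s : \sum_t A s t * u t = l * u s.
  pose w s := \sum_t A s t * u t - l * u s.
  suff : \sum_t w t ^+ 2 = 0 by move/sum_sqr_eq0/(_ s)/eqP; rewrite subr_eq0 => /eqP.
  pose W := \sum_t w t ^+ 2; pose C := qform A w - l * W.
  have W0 : 0 <= W by apply: sumr_ge0 => t _; exact: sqr_ge0.
  have C0 : 0 <= C by rewrite subr_ge0; exact: lmin.
  have H e : 0 <= e *+ 2 * W + e ^+ 2 * C.
    have := lmin (fun t => u t + e * w t); rewrite qform_line // -/l -subr_ge0.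
    have -> : \sum_t (u t + e * w t) ^+ 2 =
        1 + e *+ 2 * (\sum_t w t * u t) + e ^+ 2 * W.
      rewrite -u1 /W !mulr_sumr -!big_split /=; apply: eq_bigr => t _; ring.
    have WE : W = \sum_t w t * (\sum_r A t r * u r) - l * \sum_t w t * u t.
      rewrite mulr_sumr -sumrB; apply: eq_bigr => t _.
      by rewrite expr2 [in X in _ * X]/w; ring.
    move=> /le_trans; apply; rewrite le_eqVlt; apply/orP; left; apply/eqP.
    rewrite /C; move: WE; set a := \sum_t w t * (_); set b := \sum_t _ * _.
    move=> ->; ring.
  (* A step against the residual [w]. Dividing by [C + 1] instead of [C] keeps it defined when
     [C = 0]; the value obtained is negative unless [W = 0]. *)
  have := H (- (W / (C + 1))).
  have -> : (- (W / (C + 1))) *+ 2 * W + (- (W / (C + 1))) ^+ 2 * C =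
     - (W ^+ 2 * (C + 2) / (C + 1) ^+ 2) by field; lra.
  have C1 : 0 < C + 1 by lra.
  rewrite oppr_ge0 ler_pdivrMr ?exprn_gt0 ?mul0r //.
  rewrite -/W => WC; apply/eqP; rewrite -sqrf_eq0 eq_le sqr_ge0 andbT.
  by rewrite -(@pmulr_lle0 _ (C + 2)) //; lra.
apply: le_trans (lmin v); apply: ler_wpM2r.
  by apply: sumr_ge0 => t _; exact: sqr_ge0.
rewrite leNgt; apply/negP => /eig /(_ ueig) u0.
move: u1; rewrite big1 => [/eqP|t _]; first by rewrite eq_sym oner_eq0.
by rewrite u0 expr0n.
Qed.

End SymmetricForm.

(** * Subsets of fixed size and exchange of elements *)

Section Subsets.
Local Open Scope ring_scope.
Context {V : finType}.
Implicit Types (A B K S T U W : {set V}) (r : nat).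

Definition ksub U r : {set {set V}} := [set S : {set V} | (S \subset U) && (#|S| == r)].

Lemma ksubP U r S : reflect (S \subset U /\ #|S| = r) (S \in ksub U r).
Proof. by rewrite inE; apply: (iffP andP) => -[? /eqP]. Qed.

Lemma card_ksub U r : #|ksub U r| = 'C(#|U|, r).
Proof. exact: cards_draws. Qed.

Lemma ksub_disjoint U S r :
  [set T in ksub U r | [disjoint S & T]] = ksub (U :\: S) r.
Proof.
apply/setP => T; rewrite !inE subsetD.
by rewrite disjoint_sym -!andbA [[disjoint _ & _] && _]andbC.
Qed.

Lemma ksub_setDP U S T r :
  (T \in ksub (U :\: S) r) = (T \in ksub U r) && [disjoint S & T].
Proof. by rewrite -ksub_disjoint inE. Qed.

Lemma big_ksub_sup (R : nmodType) (F : {set V} -> R) B A r : A \subset B ->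
  \sum_(W in ksub B (#|A| + r) | A \subset W) F W =
  \sum_(K in ksub (B :\: A) r) F (A :|: K).
Proof.
move=> AB; rewrite (reindex_onto (fun K => A :|: K) (fun W => W :\: A)) /=; last first.
  by move=> W /andP[_ AW]; rewrite setDE setUIr setUCr setIT; apply/setUidPr.
apply: eq_bigl => K; rewrite subsetUl andbT; apply/idP/idP.
  move=> /andP[/ksubP [KB cK] /eqP KE].
  have dAK : [disjoint K & A] by rewrite -KE -setI_eq0 setDE -setIA [_ :&: A]setIC setICr setI0.
  have AK0 : A :&: K = set0 by apply/eqP; rewrite setI_eq0 disjoint_sym.
  rewrite ksub_setDP disjoint_sym dAK andbT; apply/ksubP; split.
    by apply: subset_trans KB; exact: subsetUr.
  by move: cK; rewrite cardsU AK0 cards0 subn0 => /addnI.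
rewrite ksub_setDP => /andP[/ksubP [KB cK] dAK].
have AK0 : A :&: K = set0 by apply/eqP; rewrite setI_eq0.
apply/andP; split.
  by apply/ksubP; rewrite subUset AB KB cardsU AK0 cards0 subn0 cK.
by rewrite setDUl setDv set0U; apply/eqP/setDidPl; rewrite disjoint_sym.
Qed.

Lemma card_ksub_sup B A r : A \subset B ->
  #|[set W in ksub B (#|A| + r) | A \subset W]| = 'C(#|B| - #|A|, r).
Proof.
move=> AB; rewrite -sum1_card.
under eq_bigl do rewrite inE.
rewrite (big_ksub_sup (fun=> 1%N)) // sum1_card card_ksub cardsD.
by have /setIidPr -> := AB.
Qed.

Lemma big_ksub_star (R : nmodType) (F : {set V} -> R) U i r : i \in U ->
  \sum_(S in ksub U r.+1 | i \in S) F S =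
  \sum_(K in ksub (U :\ i) r) F (i |: K).
Proof.
move=> iU; have := @big_ksub_sup R F U [set i] r; rewrite sub1set cards1 => <- //.
by apply: eq_bigl => S; rewrite sub1set.
Qed.

Lemma big_ksub_split (R : nmodType) (F : {set V} -> R) U i r : i \in U ->
  \sum_(S in ksub U r.+1) F S =
  \sum_(S in ksub (U :\ i) r.+1) F S + \sum_(K in ksub (U :\ i) r) F (i |: K).
Proof.
move=> iU; rewrite (bigID (fun S => i \in S)) /= big_ksub_star // addrC.
congr (_ + _); apply: eq_bigl => S; rewrite ksub_setDP.
by rewrite disjoints1.
Qed.

(** Exchanging one element at a time leads from any [r]-subset to any other, by induction on
    [#|S :\: T|]. Invariance under transpositions thus stands in for the transitive action of the
    symmetric group. *)
Lemma swap_const (X : Type) (f : {set V} -> X) U r :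
  (forall a b K, a \in U -> b \in U -> K \in ksub (U :\ a :\ b) r.-1 ->
     a != b -> f (a |: K) = f (b |: K)) ->
  {in ksub U r &, forall S T, f S = f T}.
Proof.
case: r => [|r] fswap S T.
  by move=> /ksubP[_ /cards0_eq ->] /ksubP[_ /cards0_eq ->].
move: {2}#|S :\: T| (erefl #|S :\: T|) => n.
elim: n S => [|n IH] S.
  move/eqP; rewrite cards_eq0 setD_eq0 => ST /ksubP[_ cS] /ksubP[_ cT].
  by congr f; apply/eqP; rewrite eqEcard ST cS cT leqnn.
move=> cST SU TU; have [Ss Sc] := ksubP _ _ _ SU; have [Ts Tc] := ksubP _ _ _ TU.
have /card_gt0P [a] : (0 < #|S :\: T|)%N by rewrite cST.
rewrite inE => /andP[aT aS].
have /card_gt0P [b] : (0 < #|T :\: S|)%N.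
  have := cardsID S T; have := cardsID T S; rewrite setIC; lia.
rewrite inE => /andP[bS bT].
have ab : a != b by apply: contraNneq bS => <-.
pose K := S :\ a.
have aK : a \notin K by rewrite !inE eqxx.
have bK : b \notin K by rewrite !inE (negPf bS) andbF.
have SE : S = a |: K by rewrite setD1K.
have cK : #|K| = r by move: Sc; rewrite SE cardsU1 aK => -[].
have bU : b \in U := subsetP Ts _ bT.
have aU : a \in U := subsetP Ss _ aS.
have KU : K \in ksub (U :\ a :\ b) r.
  by apply/ksubP; split=> //; rewrite !subsetD1 aK bK !andbT (subset_trans (subsetDl _ _) Ss).
rewrite SE (fswap a b) //; apply: IH => //.
  have -> : (b |: K) :\: T = (S :\: T) :\ a.
    apply/setP => x; rewrite !inE; case: (eqVneq x b) => [->|_] /=.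
      by rewrite bT /= andbF.
    by rewrite andbCA.
  by move: cST; rewrite (cardsD1 a) inE aS aT => -[].
apply/ksubP; rewrite cardsU1 bK cK; split=> //.
by rewrite subUset sub1set bU (subset_trans (subsetDl _ _) Ss).
Qed.

End Subsets.

(** * The Hoffman bound for Kneser graphs *)

Section Kneser.
Local Open Scope ring_scope.
Context {R : realType} {V : finType}.
Implicit Types (K S T U : {set V}) (r : nat) (u v : {set V} -> R).

(* Along a swap a <-> b the eigenfunction u induces an eigenfunction of the
   Kneser graph of U \ {a, b} with parameter r and opposite eigenvalue, which
   is at most the degree of that graph in absolute value. *)
Lemma kneser_eigen U r u l : (r.+1.*2 <= #|U|)%N ->
  l < - ('C(#|U| - r.+2, r))%:R ->
  (forall S, S \in ksub U r.+1 -> \sum_(T in ksub (U :\: S) r.+1) u T = l * u S) ->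
  forall S, S \in ksub U r.+1 -> u S = 0.
Proof.
move=> Ur lmu ueig.
have l_lt0 : l < 0 by apply: lt_le_trans lmu _; rewrite oppr_le0.
have uconst : {in ksub U r.+1 &, forall S T, u S = u T}.
  apply: swap_const => a b K0 aU bU K0U ab.
  pose d K := u (a |: K) - u (b |: K).
  have cUab : #|U :\ a :\ b| = (#|U| - 2)%N.
    have := cardsD1 a U; have := cardsD1 b (U :\ a).
    by rewrite !inE eq_sym ab aU bU; lia.
  (* The neighbours that avoid both [a] and [b] contribute equally to the two eigenvalue equations
     and cancel. What remains are the neighbours of [a |: K] through [b] minus those of [b |: K]
     through [a], whence the opposite sign. *)
  have dE K : K \in ksub (U :\ a :\ b) r ->
      \sum_(K' in ksub (U :\ a :\ b :\: K) r) d K' = - l * d K.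
    move=> /ksubP[KU cK]; have := KU; rewrite !subsetD1 => /andP[/andP[KUU aK] bK].
    have aux x y : x \in U -> y \in U -> x != y -> x \notin K -> y \notin K ->
        \sum_(T in ksub (U :\: (x |: K)) r.+1) u T =
        \sum_(T in ksub (U :\ x :\ y :\: K) r.+1) u T +
        \sum_(T in ksub (U :\ x :\ y :\: K) r) u (y |: T).
      move=> xU yU xy xK yK.
      have -> : U :\ x :\ y :\: K = (U :\: (x |: K)) :\ y.
        by apply/setP => z; rewrite !inE; do ![case: (_ == _)|case: (_ \in _)].
      apply: big_ksub_split; rewrite !inE yU andbT.
      by rewrite negb_or eq_sym xy yK.
    have ksx x : x \in U -> x \notin K -> x |: K \in ksub U r.+1.
      by move=> xU xK; apply/ksubP; rewrite subUset sub1set xU KUU cardsU1 xK cK.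
    have := ueig _ (ksx a aU aK); rewrite (aux a b) //.
    have := ueig _ (ksx b bU bK); rewrite (aux b a) // 1?eq_sym //.
    have -> : U :\ b :\ a = U :\ a :\ b by rewrite !setDDl setUC.
    rewrite /d sumrB; set x := \sum_(_ in _) u _; move=> h1 h2.
    by rewrite mulrBr !mulNr -h1 -h2; ring.
  have [K1 K1U K1max] : exists2 K1, K1 \in ksub (U :\ a :\ b) r &
      forall K, K \in ksub (U :\ a :\ b) r -> `|d K| <= `|d K1|.
    by case: (arg_maxP (fun K => `|d K|) K0U) => K1 K1U K1m; exists K1.
  have cK1 : #|U :\ a :\ b :\: K1| = (#|U| - r.+2)%N.
    have [K1s <-] := ksubP _ _ _ K1U.
    by have := cardsID K1 (U :\ a :\ b); have /setIidPr -> := K1s; rewrite cUab; lia.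
  have H : - l * `|d K1| <= 'C(#|U| - r.+2, r)%:R * `|d K1|.
    rewrite -[- l]gtr0_norm ?oppr_gt0 // -normrM -dE //.
    apply: le_trans (ler_norm_sum _ _ _) _.
    rewrite -cK1 -card_ksub -sumr_const mulr_suml; under [leRHS]eq_bigr do rewrite mul1r.
    by apply: ler_sum => K; rewrite ksub_setDP => /andP[KU _]; exact: K1max.
  have d1 : `|d K1| <= 0.
    rewrite leNgt; apply/negP => d_gt0; move: H; rewrite ler_pM2r //.
    by rewrite leNgt ltrNr lmu.
  by apply/eqP; rewrite -subr_eq0 -normr_le0; apply: le_trans (K1max _ K0U) d1.
(* A constant nonzero [u] would have the degree of the graph as its eigenvalue, and that is not
   negative. *)
move=> S SU; have := ueig _ SU.
rewrite (eq_bigr (fun=> u S)) => [|T]; last first.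
  by rewrite ksub_setDP => /andP[TU _]; exact: uconst.
rewrite sumr_const -mulr_natl => /eqP; rewrite -subr_eq0 -mulrBl mulf_eq0.
case/orP => [|/eqP //]; rewrite subr_eq0 => /eqP E.
by move: l_lt0; rewrite -E ltNge ler0n.
Qed.

Lemma kneser_ge U r v : (r.+1.*2 <= #|U|)%N ->
  - ('C(#|U| - r.+2, r))%:R * \sum_(S in ksub U r.+1) v S ^+ 2 <=
  \sum_(S in ksub U r.+1) \sum_(T in ksub (U :\: S) r.+1) v S * v T.
Proof.
move=> Ur.
pose A S T : R := ((S \in ksub U r.+1) && (T \in ksub (U :\: S) r.+1))%:R.
have sumA S (F : {set V} -> R) : \sum_T A S T * F T =
    (S \in ksub U r.+1)%:R * \sum_(T in ksub (U :\: S) r.+1) F T.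
  rewrite mulr_sumr [RHS]big_mkcond /=; apply: eq_bigr => T _; rewrite /A.
  by case: (S \in _) => /=; case: (T \in _) => /=; rewrite ?mul0r ?mul1r.
pose w S := if S \in ksub U r.+1 then v S else 0.
have := @qform_ge R _ A ('C(#|U| - r.+2, r))%:R _ _ w.
have -> : \sum_S w S ^+ 2 = \sum_(S in ksub U r.+1) v S ^+ 2.
  rewrite [RHS]big_mkcond /=; apply: eq_bigr => S _; rewrite /w.
  by case: ifP => //; rewrite expr0n.
have -> : qform A w =
    \sum_(S in ksub U r.+1) \sum_(T in ksub (U :\: S) r.+1) v S * v T.
  rewrite /qform [RHS]big_mkcond /=; apply: eq_bigr => S _; rewrite sumA /w.
  case: ifP => _; rewrite ?mul0r // mul1r; apply: eq_bigr => T.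
  by rewrite ksub_setDP => /andP[-> _].
apply.
  move=> S T; rewrite /A !ksub_setDP disjoint_sym.
  by case: (S \in _); rewrite /= ?andbF ?andbT.
move=> u l lmu ueig S; have [SU|SU] := boolP (S \in ksub U r.+1).
  apply: (kneser_eigen Ur lmu) SU => {}S SU.
  by have := ueig S; rewrite sumA SU mul1r.
(* Off [ksub U r.+1] the rows of [A] are zero, so an eigenvector with [l < 0] vanishes there. *)
have := ueig S; rewrite sumA (negPf SU) mul0r => /esym/eqP; rewrite mulf_eq0.
case/orP => /eqP // l0; move: lmu; rewrite l0 ltNge oppr_le0 ler0n //.
Qed.

End Kneser.

(** * Certificates of the Lovasz-Schrijver operator *)

Section Moments.
Local Open Scope ring_scope.
Context {R : realType}.

Lemma psdD n (A B : 'M[R]_n) : psd A -> psd B -> psd (A + B).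
Proof. by move=> pA pB v; rewrite mulmxDr mulmxDl mxE addr_ge0 ?pA ?pB. Qed.

Lemma psd_gram m n (A : 'M[R]_(m, n)) : psd (A *m A^T).
Proof.
move=> v; rewrite mulmxA -mulmxA -{1}[A]trmxK -trmx_mul mxE.
by apply: sumr_ge0 => i _; rewrite mxE -expr2 sqr_ge0.
Qed.

Lemma psd_block0 m n (A : 'M[R]_n) : psd A ->
  psd (block_mx 0 0 0 A : 'M[R]_(m + n)).
Proof.
move=> pA v; rewrite -[v]vsubmxK tr_col_mx mul_row_block !mulmx0 !addr0 add0r.
by rewrite mul_row_col mul0mx add0r; exact: pA.
Qed.

(** Schur complement of the corner entry: the bordered matrix is the rank-one matrix of [hvec 1 x]
    plus [M - x *m x^T] in the lower block. *)
Lemma LSp_moments n (P : classical_sets.set 'cV[R]_n) (x : 'cV[R]_n)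
    (M : 'M[R]_n) :
  M^T = M -> (forall i, M i i = x i 0) ->
  (forall i, Kcone P (hvec (x i 0) (col i M)) /\
             Kcone P (hvec (1 - x i 0) (x - col i M))) ->
  psd (M - x *m x^T) -> LSp P x.
Proof.
move=> Ms Md MK Mp; exists (block_mx 1%:M x^T x M).
have Y0 : block_mx 1%:M x^T x M *m e0 = hvec 1 x.
  by rewrite /e0 -colE block_mxEh colKl col_id.
have Yi i : block_mx 1%:M x^T x M *m e_ i = hvec (x i 0) (col i M).
  rewrite /e_ -colE block_mxEh colKr /hvec; apply/colP => j.
  rewrite !mxE; case: (split j) => k; rewrite !mxE //.
  by rewrite !ord1 eqxx mulr1n.
split.
- by rewrite tr_block_mx trmx1 trmxK Ms.
- split=> //; apply/colP => j; rewrite mxE /hvec.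
  case: (split_ordP j) => k ->; rewrite ?block_mxEul ?block_mxEdr ?col_mxEu ?col_mxEd ?ord1 //.
- move=> i; rewrite mulmxBr Yi Y0; have [K1 K2] := MK i; split=> //.
  suff -> : hvec 1 x - hvec (x i 0) (col i M) =
    hvec (1 - x i 0) (x - col i M) by [].
  by rewrite /hvec opp_col_mx add_col_mx raddfB.
- have -> : block_mx 1%:M x^T x M =
      hvec 1 x *m (hvec 1 x)^T + block_mx 0 0 0 (M - x *m x^T).
    rewrite /hvec tr_col_mx mul_col_row add_block_mx trmx1 !mul1mx mulmx1 !addr0.
    by rewrite addrC subrK.
  by apply: psdD; [exact: psd_gram|exact: psd_block0].
Qed.

(** The point [x0] witnesses that the zero vector, the value of an empty sum, is in the cone. *)
Lemma Kcone_sum n (P : classical_sets.set 'cV[R]_n) (I : finType) (Q : pred I)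
    (l : I -> R) (w : I -> 'cV[R]_n) (x0 : 'cV[R]_n) :
  convex_set P -> P x0 ->
  (forall i, Q i -> 0 <= l i) -> (forall i, Q i -> P (w i)) ->
  Kcone P (hvec (\sum_(i | Q i) l i) (\sum_(i | Q i) l i *: w i)).
Proof.
move=> cP P0 l0 wP.
have -> : hvec (\sum_(i | Q i) l i) (\sum_(i | Q i) l i *: w i) =
    \sum_(i | Q i) hvec (l i) (l i *: w i).
  elim/big_rec3: _ => [|i x y z _ <-]; last by rewrite hvecD.
  by rewrite /hvec raddf0 col_mx0.
elim/big_ind: _ => [|x y|i Qi]; last by exists (l i), (w i); split; auto.
  by exists 0, x0; split=> //; rewrite /hvec scale0r raddf0 col_mx0.
exact: KconeD.
Qed.

End Moments.

(** * Points that are 0/1 off a vertex set, and their certificates *)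

Section PartialConfigurations.
Local Open Scope ring_scope.
Context {R : realType} {V : finType}.
Variables (b q : nat).
Hypotheses (q_gt0 : (0 < q)%N).
Implicit Types (S T U W : {set V}) (F : {set {set V}}) (y : {set V} -> R).

(** For [V = 'I_p] this unfolds to [complete_hypergraph p q]. *)
Definition qsets : {set {set V}} := [set S : {set V} | #|S| == q].

Definition evec (x : {set V} -> R) : 'cV[R]_#|qsets| := \col_j x (enum_val j).

Lemma evec_mxE x j : evec x j 0 = x (enum_val j).
Proof. by rewrite mxE. Qed.

Lemma eq_evec (x y : {set V} -> R) : {in qsets, x =1 y} -> evec x = evec y.
Proof. by move=> xy; apply/colP => j; rewrite !mxE xy // enum_valP. Qed.

Lemma ksub_qsets U S : S \in ksub U q = (S \subset U) && (S \in qsets).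
Proof. by rewrite !inE. Qed.

Lemma LSp_evec (P : classical_sets.set 'cV[R]_#|qsets|) (x : {set V} -> R)
    (M : {set V} -> {set V} -> R) :
  {in qsets &, forall S T, M S T = M T S} ->
  {in qsets, forall S, M S S = x S} ->
  {in qsets, forall S, Kcone P (hvec (x S) (evec (M S))) /\
     Kcone P (hvec (1 - x S) (evec (fun T => x T - M S T)))} ->
  (forall v : {set V} -> R, 0 <= \sum_(S in qsets) \sum_(T in qsets)
     (M S T - x S * x T) * (v S * v T)) ->
  LSp P (evec x).
Proof.
move=> Ms Md MK Mp.
pose A : 'M[R]_#|qsets| := \matrix_(i, j) M (enum_val i) (enum_val j).
have AM i : col i A = evec (M (enum_val i)).
  by apply/colP => j; rewrite !mxE Ms ?enum_valP.
apply: (@LSp_moments _ _ P (evec x) A).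
- by apply/matrixP => i j; rewrite !mxE Ms ?enum_valP.
- by move=> i; rewrite !mxE Md ?enum_valP.
- move=> i; rewrite AM evec_mxE; have [K1 K2] := MK _ (enum_valP i); split=> //.
  suff -> : evec x - evec (M (enum_val i)) =
    evec (fun T => x T - M (enum_val i) T) by [].
  by apply/colP => j; rewrite !mxE.
(* The test vector [w] as a function on sets: the sum has one term on [qsets] and none elsewhere. *)
move=> w; pose v S := \sum_(j < #|qsets| | enum_val j == S) w j 0.
have vE j : v (enum_val j) = w j 0.
  by rewrite /v (big_pred1 j) // => k; rewrite (inj_eq enum_val_inj).
have := Mp v; congr (_ <= _); rewrite big_enum_val /=.
under eq_bigr do rewrite big_enum_val.
rewrite exchange_big /= [RHS]mxE; apply: eq_bigr => j _.
rewrite mxE mulr_suml; apply: eq_bigr => i _.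
rewrite !mxE big_ord1 !mxE !vE; ring.
Qed.

(* The edges of F are chosen, those inside U have the weights y, and all others
   are rejected. *)
Definition ext F U y : {set V} -> R :=
  fun T => if T \in F then 1 else if T \subset U then y T else 0.

(** Since the chosen edges avoid [U], every vertex of [U] still has its whole degree [b] to spend on
    edges inside [U]. *)
Definition valid F U :=
  (forall T, T \in F -> #|T| = q /\ [disjoint T & U]) /\
  (forall i, #|[set T in F | i \in T]| <= b)%N.

Lemma valid_notin F U S : valid F U -> S \in F -> S \subset U = false.
Proof.
move=> [vF _] /vF[cS dS]; apply/negP => SU.
move: dS; rewrite -setI_eq0; have /setIidPl -> := SU => /eqP S0.
by move: q_gt0; rewrite -cS S0 cards0.
Qed.

(** The degree of a vertex of [U] comes from [y] alone, that of any other vertex from [F] alone. *)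
Lemma bMT_ext F U y : valid F U ->
  (forall T, T \in ksub U q -> 0 <= y T <= 1) ->
  (forall i, i \in U -> \sum_(T in ksub U q | i \in T) y T <= b%:R) ->
  bMT b qsets (evec (ext F U y)).
Proof.
move=> vF y01 yb; split=> [j|i].
  rewrite evec_mxE /ext; case: ifP => _; first by rewrite ler01 lexx.
  case: ifP => ej; last by rewrite lexx ler01.
  by apply: y01; rewrite ksub_qsets ej enum_valP.
under eq_bigr do rewrite evec_mxE.
rewrite -(big_enum_val_cond (fun S : {set V} => i \in S) (ext F U y)) /=.
have [iU|iU] := boolP (i \in U).
  apply: le_trans (yb i iU); rewrite [leRHS]big_mkcond [leLHS]big_mkcond /=.
  apply: ler_sum => S _; rewrite ksub_qsets /ext.
  case: ifP => /andP; last first.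
    by case: ifP => // /andP[/andP[_ ->] ->] [].
  move=> [-> iS]; rewrite iS /= !andbT.
  case: ifP => // /(proj1 vF) [_ dS].
  by have := disjointFr dS iS; rewrite iU.
have [_ /(_ i) Fi] := vF; apply: (@le_trans _ _ (#|[set T in F | i \in T]|)%:R).
  rewrite -sum1_card natr_sum big_mkcond [leRHS]big_mkcond /=.
  apply: ler_sum => S _; rewrite [S \in [set T in F | i \in T]]inE /ext.
  case: ifP => /andP; last by case: ifP => //; rewrite ler01.
  move=> [_ iS]; rewrite iS andbT; case: ifP => // _; case: ifP => // SU.
  by move: iU; rewrite (subsetP SU).
by rewrite ler_nat.
Qed.

Lemma sum_star U y : \sum_(i in U) \sum_(T in ksub U q | i \in T) y T =
  q%:R * \sum_(T in ksub U q) y T.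
Proof.
rewrite (exchange_big_dep (fun T => T \in ksub U q)) /=; last by move=> i T _ /andP[].
rewrite mulr_sumr; apply: eq_bigr => T TU; rewrite TU /=.
have [Ts cT] := ksubP _ _ _ TU.
rewrite (eq_bigl (fun i => i \in T)) ?sumr_const ?cT ?mulr_natl // => i.
by case: (boolP (i \in T)) => [/(subsetP Ts) ->|_]; rewrite ?andbF.
Qed.

(* Tightness makes the all-ones vector an eigenvector of M in the kernel of
   M - c^2 J, so v may be shifted to have sum 0, where J vanishes. *)
Lemma tight_psd U (M : {set V} -> {set V} -> R) (c : R) :
  (q <= #|U|)%N ->
  c * 'C(#|U|.-1, q.-1)%:R = b%:R ->
  {in ksub U q &, forall S T, M S T = M T S} ->
  (forall S i, S \in ksub U q -> i \in U ->
     \sum_(T in ksub U q | i \in T) M S T = c * b%:R) ->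
  (forall v : {set V} -> R, 0 <= \sum_(S in ksub U q) \sum_(T in ksub U q)
     M S T * (v S * v T)) ->
  forall v : {set V} -> R, 0 <= \sum_(S in ksub U q) \sum_(T in ksub U q)
     (M S T - c ^+ 2) * (v S * v T).
Proof.
move=> qU cb Ms Mt Mp v; set K := ksub U q in Ms Mt Mp *.
have q0 : q%:R != 0 :> R by rewrite pnatr_eq0 -lt0n.
pose C : R := 'C(#|U|, q)%:R; pose N : R := #|U|%:R.
have C_gt0 : 0 < C by rewrite ltr0n bin_gt0.
have NbC : N * b%:R / q%:R = c * C.
  have /(congr1 (fun k => k%:R : R)) : (#|U| * 'C(#|U|.-1, q.-1) = q * 'C(#|U|, q))%N.
    by rewrite -{2 3}(prednK q_gt0) -mul_bin_diag.
  rewrite !natrM -/N -/C -cb mulrCA => ->; field; exact: q0.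
pose rho := c * (c * C).
have row S : S \in K -> \sum_(T in K) M S T = rho.
  move=> SK; apply: (mulfI q0); rewrite -sum_star /rho -NbC.
  rewrite (eq_bigr (fun=> c * b%:R)) => [|i iU]; last exact: Mt.
  by rewrite sumr_const -mulr_natl -/N; field.
pose s := \sum_(S in K) v S.
have := Mp (fun S => v S - s / C).
have -> : \sum_(S in K) \sum_(T in K) M S T * ((v S - s / C) * (v T - s / C)) =
  \sum_(S in K) \sum_(T in K) M S T * (v S * v T) - s / C * (rho * s)
   - s / C * (rho * s) + (s / C) ^+ 2 * (rho * C).
  have -> : rho * C = \sum_(S in K) \sum_(T in K) M S T.
    rewrite (eq_bigr (fun=> rho)) => [|S SK]; last exact: row.
    by rewrite sumr_const card_ksub mulr_natr.
  have e1 : rho * s = \sum_(S in K) \sum_(T in K) M S T * v S.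
    rewrite mulr_sumr; apply: eq_bigr => S SK.
    by rewrite -mulr_suml row // mulrC.
  have e2 : rho * s = \sum_(S in K) \sum_(T in K) M S T * v T.
    rewrite e1 exchange_big /=; apply: eq_bigr => S SK.
    by apply: eq_bigr => T TK; rewrite Ms.
  rewrite {1}e1 e2 !mulr_sumr -!sumrB -big_split /=; apply: eq_bigr => S _.
  rewrite !mulr_sumr -!sumrB -big_split /=; apply: eq_bigr => T _; ring.
have -> : \sum_(S in K) \sum_(T in K) (M S T - c ^+ 2) * (v S * v T) =
  \sum_(S in K) \sum_(T in K) M S T * (v S * v T) - c ^+ 2 * s ^+ 2.
  have -> : s ^+ 2 = \sum_(S in K) \sum_(T in K) v S * v T.
    by rewrite expr2 big_distrlr.
  rewrite mulr_sumr -sumrB; apply: eq_bigr => S _.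
  by rewrite mulr_sumr -sumrB; apply: eq_bigr => T _; ring.
congr (_ <= _); rewrite /rho; field; exact: lt0r_neq0.
Qed.

(** A coordinate [S] not inside [U] is 0 or 1, which forces the entries [x S * x T] in its row.
    There the cone conditions hold by themselves and the Schur complement vanishes, so only the
    block [M] on the edges inside [U] has to be provided. *)
Lemma LSp_ext (P : classical_sets.set 'cV[R]_#|qsets|) F U
    (M : {set V} -> {set V} -> R) (c : R) :
  valid F U -> (q <= #|U|)%N ->
  c * 'C(#|U|.-1, q.-1)%:R = b%:R ->
  {in ksub U q &, forall S T, M S T = M T S} ->
  {in ksub U q, forall S, M S S = c} ->
  (forall S i, S \in ksub U q -> i \in U ->
     \sum_(T in ksub U q | i \in T) M S T = c * b%:R) ->
  (forall v : {set V} -> R, 0 <= \sum_(S in ksub U q) \sum_(T in ksub U q)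
     M S T * (v S * v T)) ->
  P (evec (ext F U (fun=> c))) ->
  {in ksub U q, forall S,
     Kcone P (hvec c (evec (fun T =>
       if T \subset U then M S T else c * ext F U (fun=> c) T))) /\
     Kcone P (hvec (1 - c) (evec (fun T =>
       if T \subset U then c - M S T else (1 - c) * ext F U (fun=> c) T)))} ->
  LSp P (evec (ext F U (fun=> c))).
Proof.
move=> vF qU cb Ms Md Mt Mp Pc MK; set x := ext F U (fun=> c) in Pc MK *.
have xU S : S \subset U -> x S = c.
  by rewrite /x /ext; case: ifP => [/(valid_notin vF) ->|_ ->].
have x01 S : ~~ (S \subset U) -> x S = 0 \/ x S = 1.
  by rewrite /x /ext; case: ifP => [|_ /negPf ->]; [right|left].
pose M' S T := if (S \subset U) && (T \subset U) then M S T else x S * x T.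
apply: (@LSp_evec P x M').
- move=> S T Sq Tq; rewrite /M' andbC; case: ifP => [/andP[TU SU]|_].
    by rewrite Ms // ksub_qsets ?SU ?TU.
  exact: mulrC.
- move=> S Sq; rewrite /M' andbb; case: ifP => [SU|/negbT/x01[] ->]; rewrite ?mulr0 ?mulr1 //.
  by rewrite xU // Md // ksub_qsets SU.
- move=> S Sq; have [SU|SU] := boolP (S \subset U).
    rewrite xU //; have [|K1 K2] := MK S; first by rewrite ksub_qsets SU.
    split.
      move: K1; congr (Kcone P (hvec _ _)); apply: eq_evec => T _.
      by rewrite /M' SU /=; case: ifP => // _; rewrite (xU S).
    move: K2; congr (Kcone P (hvec _ _)); apply: eq_evec => T _.
    rewrite /M' SU /=; case: ifP => [/xU ->//|_]; rewrite (xU S) //; ring.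
  have ME : evec (M' S) = x S *: evec x.
    by apply/colP => j; rewrite !mxE /M' (negPf SU).
  have ME' : evec (fun T => x T - M' S T) = (1 - x S) *: evec x.
    by apply/colP => j; rewrite !mxE /M' (negPf SU) mulrBl mul1r.
  rewrite ME ME'; split.
    by exists (x S), (evec x); split=> //; case: (x01 S SU) => ->.
  by exists (1 - x S), (evec x); split=> //; case: (x01 S SU) => ->; lra.
- move=> v; have := tight_psd qU cb Ms Mt Mp v; congr (_ <= _).
  rewrite big_mkcond [RHS]big_mkcond /=; apply: eq_bigr => S _.
  rewrite ksub_qsets; case: (boolP (S \in qsets)) => Sq; rewrite ?andbF // andbT.
  case: ifP => SU; last first.
    by rewrite big1 // => T _; rewrite /M' SU subrr mul0r.
  rewrite big_mkcond [RHS]big_mkcond /=; apply: eq_bigr => T _.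
  rewrite ksub_qsets; case: (boolP (T \in qsets)) => Tq; rewrite ?andbF // andbT.
  rewrite /M' SU /=; case: ifP => TU; last by rewrite subrr mul0r.
  by rewrite !xU // expr2.
Qed.

End PartialConfigurations.

Lemma card_ksub_star (V : finType) (U : {set V}) i r : i \in U -> (0 < r)%N ->
  (\sum_(S in ksub U r | i \in S) 1 = 'C(#|U|.-1, r.-1))%N.
Proof.
move=> iU; case: r => // r _.
rewrite (big_ksub_star (fun=> 1%N)) // sum1_card card_ksub.
by rewrite (cardsD1 i U) iU.
Qed.

(** * The last round *)

Section OneStep.
Local Open Scope ring_scope.
Context {R : realType} {V : finType}.
Variables (b q : nat).
Hypotheses (b_gt0 : (0 < b)%N) (q_gt0 : (0 < q)%N).
Implicit Types (S T U W : {set V}) (F : {set {set V}}) (v y : {set V} -> R).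

Lemma sum_star_const U i (x : R) : i \in U ->
  \sum_(T in ksub U q | i \in T) x = 'C(#|U|.-1, q.-1)%:R * x.
Proof.
move=> iU; rewrite -(card_ksub_star iU q_gt0) natr_sum mulr_suml.
by apply: eq_bigr => T _; rewrite mul1r.
Qed.

Lemma LSp_bMT_ext F U (c : R) :
  valid b q F U -> (q.*2 <= #|U|)%N ->
  c * 'C(#|U|.-1, q.-1)%:R = b%:R ->
  (b.*2 <= 'C(#|U|.-1, q.-1))%N ->
  LSp (@bMT R V b (qsets q)) (evec q (ext F U (fun=> c))).
Proof.
move=> vF qU cb bC.
set Cp : R := 'C(#|U|.-1, q.-1)%:R in cb.
have b1 : 1 <= b%:R :> R by rewrite ler1n.
have Cp_ge : 2 * b%:R <= Cp by rewrite /Cp -natrM ler_nat mul2n.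
have cE : c = b%:R / Cp by rewrite -cb mulfK //; apply: lt0r_neq0; lra.
have c_gt0 : 0 < c by rewrite cE divr_gt0; lra.
(* For the complementary column: [(c - c * z S T) / (1 - c)] is at most 1 because [c <= 1 - c]. *)
have c_le : c <= 2^-1 by rewrite cE ler_pdivrMr; lra.
pose g : R := (b%:R - 1) / (Cp - 1).
have gE : g * (Cp - 1) = b%:R - 1 by rewrite /g divfK //; apply: lt0r_neq0; lra.
have g0 : 0 <= g by rewrite /g divr_ge0; lra.
have g1 : g <= 1 by rewrite /g ler_pdivrMr; lra.
(* The number of edges disjoint from [S] through a fixed vertex of [U :\: S]. It is also the
   constant of [kneser_ge] for the [q]-subsets of [U], so the identity plus the Kneser matrix over
   [D] is positive semidefinite. *)
pose D : R := 'C(#|U| - q.+1, q.-1)%:R.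
have D1 : 1 <= D by rewrite /D ler1n bin_gt0; lia.
(* Given S: with weight 1 - g, S together with the uniform distribution on the
   edges disjoint from S, as for b = 1; with weight g, the all-ones point. The
   value of g makes the degrees equal to b. *)
pose z S T : R := (1 - g) * ((S == T)%:R + [disjoint S & T]%:R / D) + g.
have zs S T : z S T = z T S by rewrite /z eq_sym disjoint_sym.
have zd S : S \in ksub U q -> z S S = 1.
  move=> /ksubP[_ cS]; rewrite /z eqxx (_ : [disjoint S & S] = false) /=; first by rewrite mul0r; ring.
  by apply/negP; rewrite -setI_eq0 setIid -cards_eq0 cS; lia.
have z01 S T : S \in ksub U q -> 0 <= z S T <= 1.
  move=> SU; have [<-|ST] := eqVneq S T; first by rewrite zd // ler01 lexx.
  rewrite /z (negPf ST) add0r.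
  have D0 : (0 : R) <= [disjoint S & T]%:R / D <= 1.
    by case: [disjoint _ & _]; rewrite ?mul0r ?div1r ?lexx ?ler01 // invr_ge0 invf_le1; lra.
  move: D0 => /andP[x0 x1]; apply/andP; split; nra.
have zt S i : S \in ksub U q -> i \in U -> \sum_(T in ksub U q | i \in T) z S T = b%:R.
  move=> SU iU; have [Ss cS] := ksubP _ _ _ SU.
  rewrite big_split /= -mulr_sumr big_split /= sum_star_const // -/Cp.
  suff -> : \sum_(T in ksub U q | i \in T) (S == T)%:R +
            \sum_(T in ksub U q | i \in T) [disjoint S & T]%:R / D = 1.
    by have := gE; lra.
  have [iS|iS] := boolP (i \in S).
    rewrite (bigD1 S) ?SU //= eqxx big1 => [|T /andP[_]]; last first.
      by rewrite eq_sym => /negPf ->.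
    rewrite big1 ?addr0 // => T /andP[_ iT].
    rewrite (_ : [disjoint S & T] = false) ?mul0r //.
    by apply/negP => dST; have := disjointFr dST iS; rewrite iT.
  rewrite big1 ?add0r => [|T /andP[_ iT]]; last first.
    by rewrite (_ : S == T = false) //; apply/eqP => ST; rewrite ST iT in iS.
  rewrite -mulr_suml -natr_sum.
  rewrite (_ : \sum_(T in ksub U q | i \in T) nat_of_bool [disjoint S & T] =
     'C(#|U| - q.+1, q.-1))%N; first by rewrite -/D divff //; apply: lt0r_neq0; lra.
  have iUS : i \in U :\: S by rewrite inE iS.
  have := card_ksub_star iUS q_gt0; rewrite cardsD.
  have /setIidPr -> := Ss; rewrite cS -subnS => <-.
  rewrite big_mkcond [RHS]big_mkcond /=; apply: eq_bigr => T _.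
  by rewrite ksub_setDP; case: (T \in _) => //=; case: (i \in T); case: [disjoint _ & _].
have zp v : 0 <= \sum_(S in ksub U q) \sum_(T in ksub U q) c * z S T * (v S * v T).
  have inner S : S \in ksub U q -> \sum_(T in ksub U q) c * z S T * (v S * v T) =
      c * ((1 - g) * (v S ^+ 2 + D^-1 * \sum_(T in ksub (U :\: S) q) v S * v T) +
           g * \sum_(T in ksub U q) v S * v T).
    move=> SU.
    have e1 : v S ^+ 2 = \sum_(T in ksub U q) (S == T)%:R * (v S * v T).
      rewrite (bigD1 S) //= eqxx mul1r big1 ?addr0 ?expr2 // => T /andP[_].
      by rewrite eq_sym => /negPf ->; rewrite mul0r.
    have e2 : \sum_(T in ksub (U :\: S) q) v S * v T =
        \sum_(T in ksub U q) [disjoint S & T]%:R * (v S * v T).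
      rewrite big_mkcond [RHS]big_mkcond /=; apply: eq_bigr => T _.
      by rewrite ksub_setDP; case: (T \in _) => //=; case: [disjoint _ & _];
        rewrite ?mul1r ?mul0r.
    rewrite e1 e2 !(mulrDr, mulr_sumr) -!big_split /=.
    by apply: eq_bigr => T _; rewrite /z; ring.
  rewrite (eq_bigr _ inner) -mulr_sumr; apply: mulr_ge0; first exact: ltW.
  rewrite big_split /= -!mulr_sumr big_split /= -mulr_sumr -big_distrlr /=.
  apply: addr_ge0; last by rewrite mulr_ge0 // -expr2 sqr_ge0.
  apply: mulr_ge0; first by rewrite subr_ge0.
  have := @kneser_ge R V U q.-1 v; rewrite (prednK q_gt0) => /(_ qU).
  have D_gt0 : 0 < D by lra.
  rewrite -/D -(pmulr_rge0 _ D_gt0) mulrDr mulVKf ?lt0r_neq0 //; lra.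
have q_le : (q <= #|U|)%N by lia.
have extc a y y' : a != 0 -> (forall T, a * y T = y' T) ->
    hvec a (evec q (fun T => if T \subset U then y' T else a * ext F U (fun=> c) T)) =
    hvec a (a *: evec q (ext F U y)).
  move=> a0 ay; congr (hvec _ _); apply/colP => j; rewrite !mxE /ext.
  case: ifP => TU; case: ifP => // TF.
    by rewrite (valid_notin q_gt0 vF TF) in TU.
  by rewrite TU.
apply: (LSp_ext (M := fun S T => c * z S T) q_gt0 vF q_le cb _ _ _ zp).
- by move=> S T _ _; rewrite zs.
- by move=> S SU; rewrite zd // mulr1.
- by move=> S i SU iU; rewrite -mulr_sumr zt.
- apply: bMT_ext => // [T _|i iU]; first by apply/andP; split; lra.
  by rewrite sum_star_const // mulrC cb.
move=> S SU; split.
  rewrite (extc c (z S)) //; last by rewrite lt0r_neq0.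
  exists c, (evec q (ext F U (z S))); split=> //; first exact: ltW.
  apply: bMT_ext => // [T _|i iU]; first exact: z01.
  by rewrite zt.
have c1 : 1 - c != 0 by apply: lt0r_neq0; lra.
rewrite (extc (1 - c) (fun T => (c - c * z S T) / (1 - c))) => // [|T]; last by field.
exists (1 - c), (evec q (ext F U (fun T => (c - c * z S T) / (1 - c)))); split=> //.
  by lra.
apply: bMT_ext => // [T _|i iU].
  have /andP[z0 z1] := z01 S T SU; apply/andP; split.
    by rewrite divr_ge0; nra.
  by rewrite ler_pdivrMr; nra.
rewrite -mulr_suml sumrB sum_star_const // -mulr_sumr zt // [_ * c]mulrC cb.
by rewrite le_eqVlt; apply/orP; left; apply/eqP; field.
Qed.

End OneStep.

(** * Rounds with at least 4q free vertices *)

Section Swap.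
Local Open Scope ring_scope.
Context {V : finType}.
Variables (a b : V).
Implicit Types (S T U W K : {set V}) (X : {set {set V}}).

Definition swap S : {set V} := [set x | tperm a b x \in S].
Definition swaps X : {set {set V}} := [set S | swap S \in X].

Lemma swapK : involutive swap.
Proof. by move=> S; apply/setP => x; rewrite !inE tpermK. Qed.

Lemma swapsK : involutive swaps.
Proof. by move=> X; apply/setP => S; rewrite !inE swapK. Qed.

Lemma card_swap S : #|swap S| = #|S|.
Proof. exact: (card_preimset _ (@perm_inj _ (tperm a b))). Qed.

Lemma swap_subset S T : (swap S \subset swap T) = (S \subset T).
Proof.
have H (A B : {set V}) : A \subset B -> swap A \subset swap B.
  by move=> /subsetP AB; apply/subsetP => x; rewrite !inE => /AB.
by apply/idP/idP; [rewrite -{2}[S]swapK -{2}[T]swapK|]; exact: H.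
Qed.

Lemma swap_id S : (a \in S) = (b \in S) -> swap S = S.
Proof. by move=> abS; apply/setP => x; rewrite inE; case: tpermP => // ->; rewrite abS. Qed.

Lemma swapU1 K : a \notin K -> b \notin K -> swap (a |: K) = b |: K.
Proof.
move=> aK bK; apply/setP => x; rewrite !inE; case: tpermP => [->|->|/eqP xa /eqP xb].
- by rewrite (negPf bK) (negPf aK) eq_sym.
- by rewrite !eqxx.
- by rewrite (negPf xa) (negPf xb).
Qed.

Lemma swapD S T : swap (S :\: T) = swap S :\: swap T.
Proof. by apply/setP => x; rewrite !inE. Qed.

Lemma mem_swap_ksub S U r : a \in U -> b \in U ->
  (swap S \in ksub U r) = (S \in ksub U r).
Proof.
move=> aU bU; rewrite !inE card_swap -{1}[U]swap_id ?swap_subset //.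
by rewrite aU bU.
Qed.

End Swap.

(** * Regular families of q-sets and their symmetry *)

Section RegularFamilies.
Local Open Scope ring_scope.
Context {V : finType}.
Variables (b q : nat).
Implicit Types (S T U W K : {set V}) (X : {set {set V}}).

Definition regfam W : {set {set {set V}}} :=
  [set X : {set {set V}} | (X \subset ksub W q) &&
     [forall i in W, #|[set T in X | i \in T]| == b]].

Lemma regfamP W X : reflect
  (X \subset ksub W q /\ forall i, i \in W -> #|[set T in X | i \in T]| = b)
  (X \in regfam W).
Proof.
rewrite inE; apply: (iffP andP) => -[XW].
  by move/'forall_implyP => H; split=> // i iW; exact/eqP/H.
by move=> H; split=> //; apply/'forall_implyP => i iW; exact/eqP/H.
Qed.

Lemma swaps_regfam x y W X :
  (swaps x y X \in regfam (swap x y W)) = (X \in regfam W).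
Proof.
have H W' X' : X' \in regfam W' -> swaps x y X' \in regfam (swap x y W').
  move=> /regfamP [/subsetP XW Xd]; apply/regfamP; split.
    apply/subsetP => S; rewrite inE => /XW /ksubP [SW cS].
    by apply/ksubP; rewrite -(swap_subset x y) swapK -(card_swap x y).
  move=> i; rewrite inE => /Xd <-.
  rewrite -(card_preimset _ (inv_inj (swapK x y))).
  by apply: eq_card => S; rewrite !inE swapK.
by apply/idP/idP => [/H|]; [rewrite !swapK swapsK|exact: H].
Qed.

Lemma big_regfam_swap (R : nmodType) x y W (G : {set {set V}} -> R) :
  \sum_(X in regfam (swap x y W)) G X = \sum_(X in regfam W) G (swaps x y X).
Proof.
rewrite (reindex_inj (inv_inj (swapsK x y))).
by apply: eq_bigl => X; rewrite swaps_regfam.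
Qed.

Lemma card_regfam_const U r :
  {in ksub U r &, forall W W', #|regfam W| = #|regfam W'|}.
Proof.
apply: swap_const => x y K xU yU /ksubP [KU _] _.
have xK : x \notin K by apply/negP => /(subsetP KU); rewrite !inE eqxx andbF.
have yK : y \notin K by apply/negP => /(subsetP KU); rewrite !inE eqxx.
by rewrite -(swapU1 xK yK) -!sum1_card big_regfam_swap.
Qed.

Lemma sum_regfam_star W i : i \in W ->
  (\sum_(T in ksub W q | i \in T) #|[set X in regfam W | T \in X]| =
   #|regfam W| * b)%N.
Proof.
move=> iW; rewrite -sum_nat_const.
under eq_bigr do rewrite -sum1_card.
under eq_bigr do under eq_bigl do rewrite inE.
rewrite (exchange_big_dep (fun X => X \in regfam W)) /=; last by move=> T X _ /andP[].
apply: eq_bigr => X XW; have /regfamP [XS Xd] := XW.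
rewrite -(Xd i iW) -sum1_card; apply: eq_bigl => T; rewrite [RHS]inE XW /=.
by rewrite andbC; case: (boolP (T \in X)) => //= /(subsetP XS) ->.
Qed.

(** By the swaps that fix [W], all [q]-subsets of [W] lie in equally many families. The common
    number comes from counting at a vertex of [T], where every family has degree [b]. *)
Lemma card_regfam_mem W T : (0 < q)%N -> T \in ksub W q ->
  (#|[set X in regfam W | T \in X]| * 'C(#|W|.-1, q.-1) = #|regfam W| * b)%N.
Proof.
move=> q_gt0 TW; have [Ts cT] := ksubP _ _ _ TW.
have /card_gt0P [i iT] : (0 < #|T|)%N by rewrite cT.
have iW := subsetP Ts i iT.
rewrite -(sum_regfam_star iW) -(card_ksub_star iW q_gt0) big_distrr /=.
apply: eq_bigr => S /andP[SW _]; rewrite muln1.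
have := @swap_const _ _ (fun S => #|[set X in regfam W | S \in X]|) W q.
move=> H; apply: (H _ T S TW SW) => {H} x y K xW yW /ksubP [KW _] _.
have xK : x \notin K by apply/negP => /(subsetP KW); rewrite !inE eqxx andbF.
have yK : y \notin K by apply/negP => /(subsetP KW); rewrite !inE eqxx.
have sW : swap x y W = W by rewrite swap_id // xW yW.
rewrite -(swapU1 xK yK) -[RHS](card_preimset _ (inv_inj (swapsK x y))).
apply: eq_card => X; rewrite [LHS]inE [RHS]inE [in RHS]inE.
by rewrite -{2}sW swaps_regfam; congr (_ && _); rewrite inE swapK.
Qed.

(* b of the q-subsets through a fixed point, together with their complements. *)
Lemma regfam_neq0 W : (0 < q)%N -> #|W| = q.*2 -> (b <= 'C(q.*2.-1, q.-1))%N ->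
  (0 < #|regfam W|)%N.
Proof.
move=> q_gt0 cW bq.
have /card_gt0P [i iW] : (0 < #|W|)%N by rewrite cW; lia.
pose St := [set T in ksub W q | i \in T].
have cSt : #|St| = 'C(q.*2.-1, q.-1).
  by rewrite -cW -(card_ksub_star iW q_gt0) sum1dep_card.
have [A AS cA] : exists2 A : {set {set V}}, A \subset St & #|A| = b.
  have : (0 < #|[set A : {set {set V}} | A \subset St & #|A| == b]|)%N.
    by rewrite cards_draws cSt bin_gt0.
  by case/card_gt0P => A; rewrite inE => /andP[AS /eqP cA]; exists A.
have AP T : T \in A -> [/\ T \subset W, #|T| = q & i \in T].
  by move/(subsetP AS); rewrite !inE => /andP[/andP[-> /eqP ->] ->].
have compK T : T \subset W -> W :\: (W :\: T) = T.
  by move=> TW; rewrite setDDr setDv set0U; exact/setIidPr.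
pose B := [set W :\: T | T in A].
apply/card_gt0P; exists (A :|: B); apply/regfamP; split.
  apply/subsetP => T; rewrite inE => /orP[/AP [TW cT _]|/imsetP [T' /AP [TW cT _] ->]].
    exact/ksubP.
  apply/ksubP; rewrite subsetDl cardsD; have /setIidPr -> := TW.
  by rewrite cT cW -addnn addnK.
move=> j jW.
have Binj : {in A &, injective (fun T => W :\: T)}.
  by move=> T T' /AP [TW _ _] /AP [TW' _ _] E; rewrite -(compK T) // E compK.
(* A vertex [j] lies in exactly one of [T] and [W :\: T], so each complementary pair adds one to its
   degree. No set is counted twice, as [i] lies in every member of [A] and in no member of [B]. *)
have -> : [set T in A :|: B | j \in T] =
   [set T in A | j \in T] :|: [set W :\: T | T in [set T : {set V} in A | j \notin T]].
  apply/setP => T; rewrite !inE andb_orl; congr (_ || _).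
  apply/andP/imsetP => [[/imsetP [T' T'A ->] jT]|[T']].
    by exists T' => //; move: jT; rewrite !inE jW andbT => ->; rewrite T'A.
  rewrite !inE => /andP[T'A jT'] ->; split; first exact: imset_f.
  by rewrite inE jT' jW.
rewrite cardsU card_in_imset; last first.
  move=> T T'; rewrite !inE => /andP[TA _] /andP[TA' _]; exact: Binj.
rewrite (_ : _ :&: _ = set0) ?cards0 ?subn0; last first.
  apply/setP => T; rewrite !inE; apply/negP => /andP[/andP[TA _]] /imsetP [T'].
  rewrite inE => /andP[/AP [_ _ iT'] _] TE; have [_ _] := AP T TA.
  by rewrite TE inE iT'.
rewrite -cA -(cardsID [set T : {set V} | j \in T] A); congr (_ + _)%N; apply: eq_card => T; rewrite !inE //.
by rewrite andbC.
Qed.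

End RegularFamilies.

(** * Random blocks and their moment matrix *)

Lemma mul_bin_trinomial n m p : (p <= m <= n)%N ->
  ('C(n, m) * 'C(m, p) = 'C(n, p) * 'C(n - p, m - p))%N.
Proof.
move=> /andP[pm mn].
have np : (m - p <= n - p)%N by lia.
apply/eqP; rewrite -(eqn_pmul2r (fact_gt0 p)) -(eqn_pmul2r (fact_gt0 (m - p))).
rewrite -(eqn_pmul2r (fact_gt0 (n - m))); apply/eqP.
have h1 := bin_fact mn; have h2 := bin_fact pm.
have h3 := bin_fact (leq_trans pm mn); have h4 := bin_fact np.
have e : (n - p - (m - p) = n - m)%N by lia.
rewrite e in h4.
transitivity n`!.
  by rewrite -h1 -h2; ring.
by rewrite -h3 -h4; ring.
Qed.

(** Both sides count the nested pairs of a [q.-1]-set in a [q.*2.-1]-set among [n.-1] points. In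
    [bmom_psd] this makes the Kneser bound match the Cauchy-Schwarz term exactly. *)
Lemma mul_bin_block n q : (0 < q)%N -> (q.*2 <= n)%N ->
  ('C(n.-1, q.*2.-1) * 'C(q.*2.-1, q.-1) = 'C(n.-1, q.-1) * 'C(n - q, q))%N.
Proof.
move=> q_gt0 qn; have e1 : (n.-1 - q.-1 = n - q)%N by lia.
have e2 : (q.*2.-1 - q.-1 = q)%N by lia.
by rewrite mul_bin_trinomial ?e1 ?e2 //; lia.
Qed.

Section Block.
Local Open Scope ring_scope.

(** The squared deviations from the mean [s / m] have a nonnegative sum. *)
Lemma sqr_sum_le (R : realType) (I : finType) (D : {set I}) (x : I -> R) :
  (\sum_(i in D) x i) ^+ 2 <= #|D|%:R * \sum_(i in D) x i ^+ 2.
Proof.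
have [->|D0] := eqVneq D set0; first by rewrite !big_set0 expr0n mulr0.
set s := \sum_(i in D) x i; set m : R := #|D|%:R.
have m_gt0 : 0 < m by rewrite ltr0n card_gt0.
have : 0 <= m * \sum_(i in D) (x i - s / m) ^+ 2.
  by apply: mulr_ge0; [exact: ltW|apply: sumr_ge0 => i _; exact: sqr_ge0].
have e1 : s * (s / m) = \sum_(i in D) x i * (s / m) by rewrite {1}/s mulr_suml.
have e2 : m * (s / m) ^+ 2 = \sum_(i in D) (s / m) ^+ 2.
  by rewrite sumr_const -[RHS]mulr_natl.
have -> : \sum_(i in D) (x i - s / m) ^+ 2 =
    \sum_(i in D) x i ^+ 2 - 2 * (s * (s / m)) + m * (s / m) ^+ 2.
  rewrite e1 e2 mulr_sumr -sumrB -big_split /=.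
  by apply: eq_bigr => i _; ring.
move=> H; rewrite -subr_ge0; move: H; congr (_ <= _); field; exact: lt0r_neq0.
Qed.

Context {R : realType} {V : finType}.
Variables (b q : nat) (U : {set V}) (c c' : R).
Hypotheses (b_gt0 : (0 < b)%N) (q_gt0 : (0 < q)%N).
Hypothesis cardU : (q.*2.*2 <= #|U|)%N.
Hypothesis b_le : (b <= 'C(q.*2.-1, q.-1))%N.
Hypothesis cE : c * 'C(#|U|.-1, q.-1)%:R = b%:R.
Hypothesis c'E : c' * 'C((#|U| - q.*2).-1, q.-1)%:R = b%:R.
Implicit Types (S T W K : {set V}) (X : {set {set V}}) (v : {set V} -> R).
Implicit Types (p : {set V} * {set {set V}}).

Definition blocks : {set {set V} * {set {set V}}} :=
  [set p | (p.1 \in ksub U q.*2) && (p.2 \in regfam b q p.1)].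

(** The edges chosen in earlier rounds are left out; [ext_block] puts them back. *)
Definition blockpt p : {set V} -> R := ext p.2 (U :\: p.1) (fun=> c').

Lemma big_blocks (A : nmodType) (Q : pred ({set V} * {set {set V}}))
    (G : {set V} * {set {set V}} -> A) :
  \sum_(p in blocks | Q p) G p =
  \sum_(W in ksub U q.*2) \sum_(X in regfam b q W | Q (W, X)) G (W, X).
Proof.
rewrite pair_big_dep /=; apply: eq_big => [[W X]|[W X] //].
by rewrite inE /= andbA.
Qed.

Lemma blocksP p : p \in blocks ->
  [/\ p.1 \subset U, #|p.1| = q.*2, p.2 \subset ksub p.1 q &
      forall i, i \in p.1 -> #|[set T in p.2 | i \in T]| = b].
Proof. by rewrite inE => /andP[/ksubP[? ?] /regfamP[? ?]]. Qed.

Lemma card_block_compl p : p \in blocks -> #|U :\: p.1| = (#|U| - q.*2)%N.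
Proof.
by move=> /blocksP[WU cW _ _]; rewrite cardsD; have /setIidPr -> := WU; rewrite cW.
Qed.

Lemma block_mem_sub p T : p \in blocks -> T \in p.2 ->
  [/\ T \subset p.1, T \in ksub U q & (T \subset U :\: p.1) = false].
Proof.
move=> /blocksP[WU _ XW _] /(subsetP XW) /ksubP[TW cT]; split=> //.
  by apply/ksubP; split=> //; exact: subset_trans WU.
apply/negP; rewrite subsetD => /andP[_]; rewrite -setI_eq0.
have /setIidPl -> := TW => /eqP T0.
by move: q_gt0; rewrite -cT T0 cards0.
Qed.

Lemma blockptE p T : p \in blocks ->
  blockpt p T = (T \in p.2)%:R + (T \subset U :\: p.1)%:R * c'.
Proof.
move=> pB; rewrite /blockpt /ext; case: ifP => TX.
  by have [_ _ ->] := block_mem_sub pB TX; rewrite mul0r addr0.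
by rewrite add0r; case: ifP; rewrite ?mul1r ?mul0r.
Qed.

(** An edge that meets [p.1] is not inside the remaining vertex set, so the family decides it.
    Conditioning on such an edge therefore means selecting blocks. *)
Lemma blockpt_meet p T i : p \in blocks -> i \in p.1 -> i \in T ->
  blockpt p T = (T \in p.2)%:R.
Proof.
move=> pB iW iT; rewrite blockptE // (_ : _ \subset _ = false) ?mul0r ?addr0 //.
by apply/negP => /subsetP /(_ _ iT); rewrite inE iW.
Qed.

(** Tightness comes from the regularity of the family at vertices of [p.1], and from the choice of
    [c'] at the others. *)
Lemma blockpt_star p i : p \in blocks -> i \in U ->
  \sum_(T in ksub U q | i \in T) blockpt p T = b%:R.
Proof.
move=> pB iU; have [WU cW XW Xd] := blocksP pB.
have [iW|iW] := boolP (i \in p.1).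
  rewrite (eq_bigr (fun T => (T \in p.2)%:R)) => [|T /andP[_ iT]]; last first.
    exact: (blockpt_meet pB iW).
  rewrite -(Xd i iW) -sum1dep_card natr_sum big_mkcond [RHS]big_mkcond /=.
  apply: eq_bigr => T _; case: (boolP (T \in p.2)) => TX /=.
    by have [_ -> _] := block_mem_sub pB TX.
  by case: ifP.
have iUW : i \in U :\: p.1 by rewrite inE iW.
rewrite -c'E mulrC -(card_block_compl pB) -(sum_star_const q_gt0 c' iUW).
rewrite big_mkcond [RHS]big_mkcond /=; apply: eq_bigr => T _.
rewrite blockptE // ksub_qsets [X in _ = if X && _ then _ else _]ksub_qsets.
case: (boolP (T \in qsets q)) => _; rewrite ?andbF // !andbT.
have [iT|iT] := boolP (i \in T); rewrite ?andbF // !andbT.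
have -> : T \in p.2 = false.
  by apply/negP => TX; have [TW _ _] := block_mem_sub pB TX; rewrite (subsetP TW) in iW.
case: (boolP (T \subset U :\: p.1)) => TUW; rewrite add0r ?mul0r ?mul1r.
  by rewrite (subset_trans TUW (subsetDl _ _)).
by case: ifP.
Qed.

Definition swap_pair (x y : V) p := (swap x y p.1, swaps x y p.2).

Lemma swap_pairK x y : involutive (swap_pair x y).
Proof. by move=> [W X]; rewrite /swap_pair /= swapK swapsK. Qed.

Lemma swap_pair_blocks x y p : x \in U -> y \in U ->
  (swap_pair x y p \in blocks) = (p \in blocks).
Proof. by move=> xU yU; rewrite [LHS]inE [RHS]inE /= swaps_regfam mem_swap_ksub. Qed.

Lemma blockpt_swap x y p T : x \in U -> y \in U ->
  blockpt (swap_pair x y p) (swap x y T) = blockpt p T.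
Proof.
move=> xU yU; rewrite /blockpt /ext /= inE swapK.
have sU : swap x y U = U by rewrite swap_id // xU yU.
by rewrite -{1}sU -swapD swap_subset.
Qed.

(** The mean of the block points through [i], before division by their number [bcount i]. *)
Definition bsum (i : V) T := \sum_(p in blocks | i \in p.1) blockpt p T.

Definition bcount (i : V) : R := \sum_(p in blocks | i \in p.1) 1.

Lemma bsum_swap i x y T : x \in U -> y \in U -> i != x -> i != y ->
  bsum i (swap x y T) = bsum i T.
Proof.
move=> xU yU ix iy; rewrite /bsum (reindex_inj (inv_inj (swap_pairK x y))) /=.
apply: eq_big => [p|p _]; last exact: blockpt_swap.
by rewrite swap_pair_blocks // [i \in swap x y p.1]inE tpermD // eq_sym.
Qed.

Lemma bsum_star i j : i \in U -> j \in U ->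
  \sum_(T in ksub U q | j \in T) bsum i T = bcount i * b%:R.
Proof.
move=> iU jU; rewrite /bsum exchange_big /= mulr_suml; apply: eq_bigr => p /andP[pB _].
by rewrite mul1r blockpt_star.
Qed.

Lemma bsum_const_in i : i \in U ->
  {in [set T in ksub U q | i \in T] &, forall S T, bsum i S = bsum i T}.
Proof.
move=> iU S T; rewrite inE => /andP[/ksubP[SU cS] iS].
rewrite inE => /andP[/ksubP[TU cT] iT].
rewrite -(setD1K iS) -(setD1K iT).
have H : {in ksub (U :\ i) q.-1 &, forall S T, bsum i (i |: S) = bsum i (i |: T)}.
  apply: swap_const => x y K; rewrite !in_setD1 => /andP[xi xU] /andP[yi yU].
  move=> /ksubP[KU _] xy.
  have xK : x \notin K by apply/negP => /(subsetP KU); rewrite !inE eqxx !andbF.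
  have yK : y \notin K by apply/negP => /(subsetP KU); rewrite !inE eqxx.
  rewrite setUCA [in RHS]setUCA -[in RHS](@swapU1 _ x y) ?bsum_swap 1?eq_sym //.
    by rewrite !inE negb_or xi.
  by rewrite !inE negb_or yi.
have ks (Z : {set V}) : Z \subset U -> #|Z| = q -> i \in Z -> Z :\ i \in ksub (U :\ i) q.-1.
  move=> ZU cZ iZ; apply/ksubP; split; first exact: setSD.
  by move: cZ; rewrite (cardsD1 i) iZ => <-.
by apply: H; exact: ks.
Qed.

Lemma bsum_const_notin i : i \in U ->
  {in ksub (U :\ i) q &, forall S T, bsum i S = bsum i T}.
Proof.
move=> iU; apply: swap_const => x y K; rewrite !in_setD1 => /andP[xi xU] /andP[yi yU].
move=> /ksubP[KU _] xy.
have xK : x \notin K by apply/negP => /(subsetP KU); rewrite !inE eqxx !andbF.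
have yK : y \notin K by apply/negP => /(subsetP KU); rewrite !inE eqxx.
by rewrite -[in RHS](@swapU1 _ x y) ?bsum_swap // eq_sym.
Qed.

(** Swaps that fix [i] leave one value on the edges through [i] and one on the other edges. The
    tight degree at [i] determines the first, and the sum of all degrees then determines the
    second. *)
Lemma bsumE i T : i \in U -> T \in ksub U q -> bsum i T = bcount i * c.
Proof.
move=> iU; move: T.
have Cn0 : 'C(#|U|.-1, q.-1)%:R != 0 :> R by rewrite pnatr_eq0 -lt0n bin_gt0; lia.
have inE1 T : T \in ksub U q -> i \in T -> bsum i T = bcount i * c.
  move=> TU iT; apply: (mulfI Cn0).
  rewrite -(sum_star_const q_gt0 _ iU) mulrCA [_ * c]mulrC cE -(bsum_star iU iU).
  by apply: eq_bigr => S /andP[SU iS]; apply: (bsum_const_in iU); rewrite inE ?TU ?SU.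
move=> T TU; have [iT|iT] := boolP (i \in T); first exact: inE1.
have TUi : T \in ksub (U :\ i) q.
  by have [Ts cT] := ksubP _ _ _ TU; apply/ksubP; rewrite subsetD1 Ts iT.
have Cn0' : 'C(#|U|.-1, q)%:R != 0 :> R by rewrite pnatr_eq0 -lt0n bin_gt0; lia.
have q0 : q%:R != 0 :> R by rewrite pnatr_eq0 -lt0n.
have Uc : #|U :\ i| = #|U|.-1 by rewrite (cardsD1 i U) iU.
have := sum_star q U (bsum i).
rewrite (eq_bigr (fun=> bcount i * b%:R)) => [|j jU]; last exact: bsum_star.
rewrite (bigID (fun S => i \in S)) /=.
have -> : \sum_(S in ksub U q | i \in S) bsum i S =
    'C(#|U|.-1, q.-1)%:R * (bcount i * c).
  by rewrite -(sum_star_const q_gt0 _ iU); apply: eq_bigr => S /andP[SU iS]; exact: inE1.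
have -> : \sum_(S in ksub U q | i \notin S) bsum i S = 'C(#|U|.-1, q)%:R * bsum i T.
  rewrite (eq_bigl (fun S => S \in ksub (U :\ i) q)) => [|S]; last first.
    by rewrite ksub_setDP disjoints1.
  rewrite (eq_bigr (fun=> bsum i T)) => [|S SU]; last exact: bsum_const_notin.
  by rewrite sumr_const card_ksub Uc mulr_natl.
rewrite sumr_const -[_ *+ #|U|]mulr_natl.
have : #|U|%:R * b%:R = q%:R * (c * ('C(#|U|.-1, q)%:R + 'C(#|U|.-1, q.-1)%:R)).
  rewrite -natrD -cE mulrCA -natrM mulrCA -natrM; congr (_ * _%:R).
  have -> : ('C(#|U|.-1, q) + 'C(#|U|.-1, q.-1) = 'C(#|U|, q))%N.
    by rewrite -{1 3}(prednK q_gt0) -binS prednK //; lia.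
  by rewrite -{2 3}(prednK q_gt0) -mul_bin_diag.
set C1 : R := 'C(#|U|.-1, q)%:R in Cn0' *.
set C2 : R := 'C(#|U|.-1, q.-1)%:R in Cn0 *.
move=> h1; rewrite mulrCA h1 => h2.
apply: (mulfI Cn0'); apply: (mulfI q0).
move: h2; set t := bsum i T; set B := bcount i => h2.
have : q%:R * (C1 * t) = B * (q%:R * (c * (C1 + C2))) - q%:R * (C2 * (B * c)).
  by rewrite h2; ring.
by move=> ->; ring.
Qed.

Variable W0 : {set V}.
Hypothesis W0U : W0 \in ksub U q.*2.

(** Counts as reals: [r] families on each [q.*2]-subset [W] of [U], [A] blocks through each vertex
    of [U], [C3] edges inside [W] through each vertex of [W], [beta] families on [W] that contain a
    given edge. *)
Let r : R := #|regfam b q W0|%:R.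
Let A : R := r * 'C(#|U|.-1, q.*2.-1)%:R.
Let C3 : R := 'C(q.*2.-1, q.-1)%:R.
Let beta : R := r * b%:R / C3.

Lemma card_regfamE W : W \in ksub U q.*2 -> #|regfam b q W|%:R = r.
Proof. by move=> WU; rewrite /r (@card_regfam_const _ b q _ _ W W0 WU W0U). Qed.

Lemma r_gt0 : 0 < r.
Proof. by rewrite ltr0n regfam_neq0 //; have [] := ksubP _ _ _ W0U. Qed.

Lemma A_gt0 : 0 < A.
Proof. by rewrite mulr_gt0 ?r_gt0 // ltr0n bin_gt0; lia. Qed.

Lemma C3_gt0 : 0 < C3.
Proof. by rewrite ltr0n bin_gt0; lia. Qed.

Lemma bcountE i : i \in U -> bcount i = A.
Proof.
move=> iU; rewrite /bcount big_blocks /A mulrC.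
have q2_gt0 : (0 < q.*2)%N by lia.
rewrite -(sum_star_const q2_gt0 _ iU) [RHS]big_mkcondr /=.
apply: eq_bigr => W WU; case: ifP => iW; last by rewrite big_pred0 // => X; rewrite andbF.
rewrite -(card_regfamE WU) -sum1_card natr_sum; apply: eq_bigl => X.
by rewrite andbT.
Qed.

Lemma card_regfam_memE W S : W \in ksub U q.*2 -> S \in ksub W q ->
  \sum_(X in regfam b q W | S \in X) 1 = beta.
Proof.
move=> WU SW; have [_ cW] := ksubP _ _ _ WU.
have /(congr1 (fun n => n%:R : R)) := card_regfam_mem b q_gt0 SW.
rewrite !natrM card_regfamE // cW -/C3 => h.
rewrite /beta -h mulfK ?lt0r_neq0 ?C3_gt0 // -sum1dep_card natr_sum.
by apply: eq_bigl => X.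
Qed.

Lemma big_blocks_mem (B : nmodType) (G : {set V} * {set {set V}} -> B) S i :
  i \in S -> \sum_(p in blocks | S \in p.2) G p =
    \sum_(p in blocks | (i \in p.1) && (S \in p.2)) G p.
Proof.
move=> iS; apply: eq_bigl => p; apply/andP/and3P => [[pB SX]|[]//]; split=> //.
by have [/subsetP/(_ _ iS)] := block_mem_sub pB SX.
Qed.

(* For G = blockpt the right-hand side is, up to a scalar, x minus the column of
   S in the certificate; the left-hand side is a sum of block points because a
   block through i either chooses or rejects S. *)
Lemma big_blocks_notmem (B : zmodType) (G : {set V} * {set {set V}} -> B) S i :
  i \in S -> \sum_(p in blocks | (i \in p.1) && (S \notin p.2)) G p =
    \sum_(p in blocks | i \in p.1) G p - \sum_(p in blocks | S \in p.2) G p.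
Proof.
move=> iS; have -> : \sum_(p in blocks | i \in p.1) G p =
    \sum_(p in blocks | (i \in p.1) && (S \in p.2)) G p +
    \sum_(p in blocks | (i \in p.1) && (S \notin p.2)) G p.
  rewrite (bigID (fun p => S \in p.2)) /=.
  by congr (_ + _); apply: eq_bigl => p; rewrite andbA.
by rewrite -(big_blocks_mem G iS) addrC addKr.
Qed.

(** For [i] in [S], the coordinate [S] of a block point through [i] is the indicator that [S] is
    chosen, so the count is [bsum i S]. *)
Lemma blocks_memE S : S \in ksub U q -> \sum_(p in blocks | S \in p.2) 1 = c * A.
Proof.
move=> SU; have [Ss cS] := ksubP _ _ _ SU.
have /card_gt0P [i iS] : (0 < #|S|)%N by rewrite cS.
have iU := subsetP Ss i iS.
rewrite mulrC -(bcountE iU) -(bsumE iU SU) (big_blocks_mem _ iS) /bsum.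
rewrite big_mkcondr [RHS]big_mkcondr /=; apply: eq_bigr => p pB.
case: (boolP (i \in p.1)) => //= iW; rewrite (blockpt_meet pB iW iS).
by case: (S \in p.2).
Qed.

(** As a function of [T], this is [c] times the mean of the block points that choose [S]. The
    normaliser [A] counts the blocks through one vertex of [S], and only these can choose [S]. *)
Definition bmom S T := A^-1 * \sum_(p in blocks | S \in p.2) blockpt p T.

Lemma bmom_diag S : S \in ksub U q -> bmom S S = c.
Proof.
move=> SU; rewrite /bmom (eq_bigr (fun=> 1)) => [|p /andP[pB SX]]; last first.
  by rewrite /blockpt /ext SX.
by rewrite blocks_memE // mulrC mulfK // lt0r_neq0 // A_gt0.
Qed.

Lemma bmom_star S i : S \in ksub U q -> i \in U ->
  \sum_(T in ksub U q | i \in T) bmom S T = c * b%:R.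
Proof.
move=> SU iU; rewrite -mulr_sumr exchange_big /=.
rewrite (eq_bigr (fun=> 1 * b%:R)) => [|p /andP[pB _]]; last first.
  by rewrite blockpt_star // mul1r.
by rewrite -mulr_suml blocks_memE // mulrA mulrCA mulVf ?mulr1 // lt0r_neq0 // A_gt0.
Qed.

(** [W] must contain [S] and avoid [T], so its other [q] vertices come from [#|U| - q - q], and
    [beta] families on it choose [S]. *)
Lemma blocks_apart S T : S \in ksub U q -> T \in ksub U q ->
  \sum_(p in blocks | S \in p.2) (T \subset U :\: p.1)%:R =
  [disjoint S & T]%:R * (beta * 'C(#|U| - q - q, q)%:R).
Proof.
move=> SU TU; have [Ss cS] := ksubP _ _ _ SU; have [Ts cT] := ksubP _ _ _ TU.
rewrite big_blocks /=.
transitivity (\sum_(W in ksub (U :\: T) q.*2 | S \subset W) beta).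
  rewrite big_mkcond [RHS]big_mkcond /=; apply: eq_bigr => W _.
  rewrite ksub_setDP; case: (boolP (W \in ksub U q.*2)) => WU //=.
  rewrite subsetD Ts /= disjoint_sym.
  case: (boolP (S \subset W)) => SW; rewrite ?andbF ?andbT.
    have SWk : S \in ksub W q by apply/ksubP.
    case: [disjoint _ & _] => /=; first exact: card_regfam_memE.
    by rewrite big1.
  rewrite big_pred0 // => X; apply/negP => /andP[/regfamP[/subsetP XW _] /XW /ksubP[SW' _]].
  by rewrite SW' in SW.
have [dST|dST] := boolP [disjoint S & T]; last first.
  rewrite mul0r big_pred0 // => W; apply/negP => /andP[].
  rewrite ksub_setDP => /andP[_ dTW] SW; case/negP: dST.
  by rewrite disjoint_sym; exact: disjointWr dTW.
have SUT : S \subset U :\: T by rewrite subsetD Ss dST.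
rewrite mul1r sumr_const -[LHS]mulr_natr; congr (_ * _%:R).
have := card_ksub_sup q SUT; rewrite cS addnn cardsD.
have /setIidPr -> := Ts; rewrite cT => <-.
by rewrite -sum1_card -sum1dep_card; apply: eq_bigl.
Qed.

(** Separating chosen from free edges [T] makes the symmetry in [S] and [T] visible. *)
Lemma bmom_sum S T : S \in ksub U q -> T \in ksub U q ->
  \sum_(p in blocks | S \in p.2) blockpt p T =
  \sum_(p in blocks) (S \in p.2)%:R * (T \in p.2)%:R +
  [disjoint S & T]%:R * (beta * 'C(#|U| - q - q, q)%:R) * c'.
Proof.
move=> SU TU; rewrite -blocks_apart // mulr_suml.
have -> : \sum_(p in blocks) (S \in p.2)%:R * (T \in p.2)%:R =
    \sum_(p in blocks | S \in p.2) (T \in p.2)%:R :> R.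
  by rewrite [RHS]big_mkcondr /=; apply: eq_bigr => p _; case: (S \in _); rewrite ?mul1r ?mul0r.
by rewrite -big_split /=; apply: eq_bigr => p /andP[pB _]; exact: blockptE.
Qed.

Lemma bmom_sym : {in ksub U q &, forall S T, bmom S T = bmom T S}.
Proof.
move=> S T SU TU; rewrite /bmom !bmom_sum // disjoint_sym; congr (_ * (_ + _)).
by apply: eq_bigr => p _; rewrite mulrC.
Qed.

Lemma ksub_superset_sum (B : {set V}) v :
  (q <= #|B|)%N ->
  \sum_(W in ksub B q.*2) \sum_(S in ksub W q) v S =
  'C(#|B| - q, q)%:R * \sum_(S in ksub B q) v S.
Proof.
move=> qB; rewrite (exchange_big_dep (fun S => S \in ksub B q)) /=; last first.
  move=> W S /ksubP[WB _] /ksubP[SW cS]; apply/ksubP; split=> //.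
  exact: subset_trans WB.
rewrite mulr_sumr; apply: eq_bigr => S /ksubP[SB cS].
have := card_ksub_sup q SB; rewrite cS addnn => <-; rewrite mulr_natl -sumr_const.
apply: eq_bigl => W; rewrite [RHS]inE; congr (_ && _).
by apply/ksubP/idP => [[]//|SW]; split.
Qed.

Lemma blockpt_sum v p : p \in blocks ->
  \sum_(T in ksub U q) blockpt p T * v T =
  \sum_(T in ksub U q | T \in p.2) v T +
  c' * \sum_(T in ksub (U :\: p.1) q) v T.
Proof.
move=> pB; rewrite [X in _ = X + _]big_mkcondr.
have -> : \sum_(T in ksub (U :\: p.1) q) v T =
    \sum_(T in ksub U q) if T \subset U :\: p.1 then v T else 0.
  rewrite -big_mkcondr /=; apply: eq_bigl => T; rewrite !ksub_qsets.
  case: (boolP (T \subset U :\: p.1)) => TUW; rewrite ?andbF // andbT.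
  by rewrite (subset_trans TUW (subsetDl _ _)).
rewrite mulr_sumr -big_split /=; apply: eq_bigr => T _.
rewrite blockptE //; case: (T \in p.2); case: (T \subset _) => /=; ring.
Qed.

(** Blocks are grouped by [W]. Cauchy-Schwarz over the families on [W] bounds the sum of the
    [x X ^+ 2] from below by a multiple of [g W ^+ 2]. Up to a factor, the products [g W * h W] add
    up to the Kneser form of [g] on the [q.*2]-subsets of [U]. *)
Lemma bmom_psd v :
  0 <= \sum_(S in ksub U q) \sum_(T in ksub U q) bmom S T * (v S * v T).
Proof.
pose g W := \sum_(S in ksub W q) v S.
pose h W := \sum_(T in ksub (U :\: W) q) v T.
pose x X := \sum_(S in ksub U q | S \in X) v S.
have -> : \sum_(S in ksub U q) \sum_(T in ksub U q) bmom S T * (v S * v T) =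
    A^-1 * \sum_(W in ksub U q.*2) \sum_(X in regfam b q W) x X * (x X + c' * h W).
  have -> : \sum_(W in ksub U q.*2) \sum_(X in regfam b q W) x X * (x X + c' * h W) =
      \sum_(p in blocks) x p.2 * (x p.2 + c' * h p.1).
    under [RHS]eq_bigl do rewrite -[_ \in blocks]andbT.
    rewrite (big_blocks (fun=> true)).
    by apply: eq_bigr => W _; apply: eq_bigl => X; rewrite andbT.
  have row S : \sum_(T in ksub U q) bmom S T * (v S * v T) =
      A^-1 * \sum_(p in blocks | S \in p.2) v S * (x p.2 + c' * h p.1).
    rewrite /bmom mulr_sumr; under eq_bigr do rewrite mulr_sumr mulr_suml.
    rewrite exchange_big /=; apply: eq_bigr => p /andP[pB _].
    rewrite -blockpt_sum // !mulr_sumr; apply: eq_bigr => T _; ring.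
  under eq_bigr do rewrite row.
  rewrite -mulr_sumr; congr (_ * _).
  rewrite (exchange_big_dep (fun p => p \in blocks)) /=; last by move=> S p _ /andP[].
  apply: eq_bigr => p pB; rewrite {2}/x mulr_suml; apply: eq_bigl => S.
  by rewrite pB.
apply: mulr_ge0; first by rewrite invr_ge0 ltW ?A_gt0.
have sumx W : W \in ksub U q.*2 -> \sum_(X in regfam b q W) x X = beta * g W.
  move=> WU; have [WUs _] := ksubP _ _ _ WU.
  rewrite /x (exchange_big_dep (fun S => S \in ksub W q)) /=; last first.
    by move=> X S /regfamP[/subsetP XW _] /andP[_ /XW].
  rewrite /g mulr_sumr; apply: eq_bigr => S SW.
  rewrite -(card_regfam_memE WU SW) mulr_suml; apply: eq_big => [X|X _]; last by rewrite mul1r.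
  have [SWs cS] := ksubP _ _ _ SW.
  by rewrite (_ : S \in ksub U q) //; apply/ksubP; rewrite (subset_trans SWs WUs).
have low W : W \in ksub U q.*2 ->
    beta * (beta / r * g W ^+ 2 + c' * (g W * h W)) <=
    \sum_(X in regfam b q W) x X * (x X + c' * h W).
  move=> WU; under [leRHS]eq_bigr do rewrite mulrDr -expr2.
  rewrite big_split /= -mulr_suml sumx // mulrDr; apply: lerD; last first.
    by rewrite le_eqVlt; apply/orP; left; apply/eqP; ring.
  have := sqr_sum_le (regfam b q W) x; rewrite sumx // card_regfamE //.
  rewrite -ler_pdivrMl ?r_gt0 //; apply: le_trans.
  by rewrite le_eqVlt; apply/orP; left; apply/eqP; ring.
apply: le_trans (ler_sum _ _); last by move=> W WU; exact: low.
rewrite -mulr_sumr; apply: mulr_ge0.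
  by rewrite /beta divr_ge0 ?mulr_ge0 // ltW ?r_gt0 ?C3_gt0.
rewrite big_split /= -!mulr_sumr.
pose n := (#|U| - q.*2)%N.
set G := \sum_(W in ksub U q.*2) g W ^+ 2.
set Y := \sum_(W in ksub U q.*2) g W * h W.
have G0 : 0 <= G by apply: sumr_ge0 => W _; exact: sqr_ge0.
pose C1 : R := 'C(n - q, q)%:R.
pose C2 : R := 'C(n.-1, q.*2.-1)%:R.
pose C4 : R := 'C(n.-1, q.-1)%:R.
have C1_gt0 : 0 < C1 by rewrite ltr0n bin_gt0 /n; lia.
have C4_gt0 : 0 < C4 by rewrite ltr0n bin_gt0 /n; lia.
(* Each edge inside [U :\: W] lies in [C1] of its [q.*2]-subsets, so [C1 * h W] is the sum of [g]
   over the neighbours of [W]. *)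
have YG : - C2 * G <= C1 * Y.
  have q2E : q.*2 = q.*2.-1.+1 by rewrite prednK //; lia.
  have := @kneser_ge R V U q.*2.-1 g; rewrite -q2E => /(_ cardU).
  rewrite (_ : #|U| - q.*2.+1 = n.-1)%N; last by rewrite /n; lia.
  move=> /le_trans; apply; rewrite le_eqVlt; apply/orP; left; apply/eqP.
  rewrite mulr_sumr; apply: eq_bigr => W WU; have [WUs cW] := ksubP _ _ _ WU.
  have cUW : #|U :\: W| = n by rewrite cardsD; have /setIidPr -> := WUs; rewrite cW.
  rewrite -mulr_sumr ksub_superset_sum cUW; last by rewrite /n; lia.
  by rewrite mulrCA.
have CC : C2 * C3 = C4 * C1.
  by rewrite -!natrM mul_bin_block // /n; lia.
have c'E' : c' = b%:R / C4 by rewrite -c'E mulfK // lt0r_neq0.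
have -> : beta / r = b%:R / C3.
  by rewrite /beta; field; rewrite !lt0r_neq0 ?r_gt0 ?C3_gt0.
rewrite c'E' -(pmulr_rge0 _ C1_gt0).
have -> : C1 * (b%:R / C3 * G + b%:R / C4 * Y) =
    b%:R / C4 * (C1 * Y - - C2 * G).
  have -> : C2 = C4 * C1 / C3 by rewrite -CC mulfK // lt0r_neq0 ?C3_gt0.
  by field; rewrite !lt0r_neq0 ?C3_gt0.
by rewrite mulr_ge0 ?subr_ge0 // divr_ge0 // ltW.
Qed.

Lemma valid_block F p : valid b q F U -> p \in blocks ->
  valid b q (F :|: p.2) (U :\: p.1).
Proof.
move=> [vF dF] pB; have [WU cW /subsetP XW Xd] := blocksP pB; split.
  move=> T; rewrite inE => /orP[/vF[cT dT]|TX]; split=> //.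
  - exact: disjointWr (subsetDl _ _) dT.
  - by have /ksubP[] := XW _ TX.
  - have /ksubP[TW _] := XW _ TX; rewrite disjoint_sym.
    apply: disjointWr TW _; rewrite -setI_eq0; apply/eqP/setP => z.
    by rewrite !inE; case: (z \in p.1); rewrite ?andbF.
move=> i; have [iW|iW] := boolP (i \in p.1).
  rewrite -(Xd i iW); apply: subset_leq_card; apply/subsetP => T.
  rewrite !inE => /andP[/orP[/vF[_ dT]|->//] iT].
  by have := disjointFr dT iT; rewrite (subsetP WU).
apply: leq_trans (dF i); apply: subset_leq_card; apply/subsetP => T.
rewrite !inE => /andP[/orP[->//|/XW /ksubP[TW _]] iT].
by rewrite (subsetP TW) in iW.
Qed.

Lemma ext_block F p T : valid b q F U -> p \in blocks ->
  ext (F :|: p.2) (U :\: p.1) (fun=> c') T =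
  if T \subset U then blockpt p T else ext F U (fun=> c) T.
Proof.
move=> vF pB; rewrite /blockpt /ext in_setU.
have [TU|TU] := boolP (T \subset U).
  have [TF|//] := boolP (T \in F).
  by rewrite (valid_notin q_gt0 vF TF) in TU.
have TUW : (T \subset U :\: p.1) = false.
  by apply/negP => /subset_trans /(_ (subsetDl _ _)); rewrite (negPf TU).
have TX : (T \in p.2) = false.
  by apply/negP => /(block_mem_sub pB) [_ /ksubP[]]; rewrite (negPf TU).
by rewrite TX TUW orbF.
Qed.

Lemma LSp_block (P : classical_sets.set 'cV[R]_#|qsets q|) F :
  convex_set P -> valid b q F U ->
  P (evec q (ext F U (fun=> c))) ->
  (forall p, p \in blocks ->
     P (evec q (ext (F :|: p.2) (U :\: p.1) (fun=> c')))) ->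
  LSp P (evec q (ext F U (fun=> c))).
Proof.
move=> cP vF Pc Pp.
have q_le : (q <= #|U|)%N by lia.
have A0 := A_gt0; have AN : A != 0 by rewrite lt0r_neq0.
apply: (LSp_ext (M := bmom) q_gt0 vF q_le cE bmom_sym bmom_diag bmom_star bmom_psd Pc).
move=> S SU; have [Ss cS] := ksubP _ _ _ SU.
have /card_gt0P [i iS] : (0 < #|S|)%N by rewrite cS.
have iU := subsetP Ss i iS.
(* Any selection [Q] of blocks, with weight [A^-1] each, gives a cone element: on edges not inside
   [U] all its points agree with [ext F U (fun=> c)]. *)
have cone (Q : pred ({set V} * {set {set V}})) l y :
    \sum_(p in blocks | Q p) 1 = l * A ->
    (forall T, T \in ksub U q -> \sum_(p in blocks | Q p) blockpt p T = y T * A) ->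
    Kcone P (hvec l (evec q (fun T =>
      if T \subset U then y T else l * ext F U (fun=> c) T))).
  move=> lE yE.
  have := @Kcone_sum R _ P _ (fun p => (p \in blocks) && Q p) (fun=> A^-1)
    (fun p => evec q (ext (F :|: p.2) (U :\: p.1) (fun=> c'))) _ cP Pc.
  move=> H; have {H} := H _ _; rewrite -(eq_bigr _ (fun p _ => mulr1 A^-1)) -mulr_sumr lE.
  rewrite mulrCA mulVf // mulr1.
  have <- : evec q (fun T => if T \subset U then y T else l * ext F U (fun=> c) T) =
    \sum_(p in blocks | Q p) A^-1 *: evec q (ext (F :|: p.2) (U :\: p.1) (fun=> c')).
    apply/colP => j; rewrite summxE evec_mxE.
    under eq_bigr do rewrite mxE evec_mxE.
    rewrite -mulr_sumr; case: ifP => ej.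
      have ek : enum_val j \in ksub U q by rewrite ksub_qsets ej enum_valP.
      apply: (mulfI AN); rewrite mulrA divff // mul1r mulrC -yE //.
      by apply: eq_bigr => p /andP[pB _]; rewrite ext_block // ej.
    rewrite (eq_bigr (fun p => 1 * ext F U (fun=> c) (enum_val j))) => [|p /andP[pB _]].
      by rewrite -mulr_suml lE mulrA mulrCA mulVf // mulr1.
    by rewrite ext_block // ej mul1r.
  apply=> [p _|p /andP[pB _]]; last exact: Pp.
  by rewrite invr_ge0 ltW.
split.
  apply: (cone (fun p => S \in p.2)); first exact: blocks_memE.
  by move=> T TU; rewrite /bmom mulrAC mulVf // mul1r.
(* The blocks through [i] have total weight 1 and mean [c]; removing those that choose [S] leaves
   weight [1 - c] and entries [c - bmom S T]. *)
apply: (cone (fun p => (i \in p.1) && (S \notin p.2))).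
  rewrite big_blocks_notmem // blocks_memE // -/(bcount i) bcountE //; ring.
move=> T TU; rewrite big_blocks_notmem // -/(bsum i T) bsumE // bcountE //.
by rewrite /bmom mulrBl [A^-1 * _ * _]mulrAC mulVf // mul1r mulrC.
Qed.

End Block.

(** * Binomial estimates and the induction over the rounds *)

Lemma leq_sub_bin n k : n - k <= 'C(n, k.+1).
Proof.
elim: n => [|n IH] //; rewrite binS.
have [kn|kn] := leqP k n; last by lia.
have : 0 < 'C(n, k) by rewrite bin_gt0.
lia.
Qed.

Lemma bin_central r : 'C(r.+1.*2, r.+1) = 2 * 'C(r.*2.+1, r).
Proof.
rewrite doubleS binS mul2n -[RHS]addnn; congr (_ + _).
have rr : r <= r.*2.+1 by lia.
by rewrite -(bin_sub rr); congr 'C(_, _); lia.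
Qed.

(** Each step at least doubles the binomial, while [(q + 1) ^ 2 <= 2 * q ^ 2] from [q = 3] on. For
    [q = 2] the bound fails, as 4 exceeds ['C(3, 1)]. *)
Lemma leq_sqr_bin q : 2 < q -> q ^ 2 <= 'C(q.*2.-1, q.-1).
Proof.
case: q => [|[|[|q]]] // _; rewrite doubleS /=.
elim: q => [|q IH] //; rewrite doubleS binS -doubleS bin_central.
apply: leq_trans (leq_addr _ _).
apply: (@leq_trans (2 * q.+3 ^ 2)); last by rewrite leq_mul2l.
by rewrite !expnS !expn0; nia.
Qed.

Section Survival.
Context {R : realType} {V : finType}.
Variables (b q : nat).
Hypotheses (b_gt0 : 0 < b) (q_gt1 : 1 < q) (b_le : b <= q ^ 2).
Hypothesis (bq : (b, q) != (4, 2)).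
Implicit Types (U : {set V}) (F : {set {set V}}).

Let q_gt0 : 0 < q. Proof. exact: ltnW. Qed.

(** For [q = 2] the right-hand side is 3, so among [b <= 4] only [b = 4] has to be excluded, which
    [bq] does. *)
Lemma leq_bin_block : b <= 'C(q.*2.-1, q.-1).
Proof.
have [q3|q2] := ltnP 2 q; first exact: leq_trans b_le (leq_sqr_bin q3).
have E : q = 2 by lia.
by move: b_le bq; rewrite E bin1 /= xpair_eqE eqxx andbT; case: b => [|[|[|[|[|?]]]]].
Qed.

(** For [q = 2] this is [b.*2 <= n], a consequence of [b <= 4]. For larger [q], Pascal's rule gives
    two binomials of at least [b] each. *)
Lemma leq_double_bin n : b + q.*2 + q - 2 <= n -> b.*2 <= 'C(n, q.-1).
Proof.
move=> bn; have [q3|q2] := ltnP 2 q; last first.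
  have E : q = 2 by lia.
  by move: b_le bn; rewrite E bin1 /=; lia.
case: n bn => [|n bn]; first by lia.
have -> : q.-1 = (q - 3).+2 by lia.
rewrite binS; have := leq_sub_bin n (q - 3).+1; have := leq_sub_bin n (q - 3).
by lia.
Qed.

(** [F] and [U] vary in the induction, since a block changes both. A round costs the [q.*2] vertices
    of its block; the round applied to the polytope itself goes through [LSp_bMT_ext]. *)
Lemma LSp_iter_ext j U F (c : R) :
  valid b q F U -> b + q - 1 + 2 * q * j <= #|U| ->
  (c * 'C(#|U|.-1, q.-1)%:R = b%:R)%R ->
  LSp_iter j (@bMT R V b (qsets q)) (evec q (ext F U (fun=> c))).
Proof.
elim: j U F c => [|[_|j IH]] U F c vF cU cE.
(* This gives [c <= 1]. The assumption [b + q - 1 <= #|U|] says exactly that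
   [b <= #|U|.-1 - (q - 2)]. *)
- have bC : b <= 'C(#|U|.-1, q.-1).
    have -> : q.-1 = (q - 2).+1 by lia.
    by apply: leq_trans (leq_sub_bin _ _); lia.
  have cE' : (c = b%:R / 'C(#|U|.-1, q.-1)%:R)%R.
    by rewrite -cE mulfK // pnatr_eq0 -lt0n (leq_trans b_gt0).
  apply: bMT_ext => // [T _|i iU].
    rewrite cE' divr_ge0 ?ler0n //= ler_pdivrMr ?mul1r ?ler_nat //.
    by rewrite ltr0n (leq_trans b_gt0).
  by rewrite sum_star_const // mulrC cE.
- by apply: LSp_bMT_ext => //; [lia|apply: leq_double_bin; lia].
(* At least two rounds remain here, which leaves enough vertices for the Kneser bound on
   [q.*2]-subsets. *)
have cardU : q.*2.*2 <= #|U| by lia.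
have /card_gt0P [W0 W0U] : 0 < #|ksub U q.*2| by rewrite card_ksub bin_gt0; lia.
pose c' : R := (b%:R / 'C((#|U| - q.*2).-1, q.-1)%:R)%R.
have c'E : (c' * 'C((#|U| - q.*2).-1, q.-1)%:R = b%:R)%R.
  by rewrite /c' divfK // pnatr_eq0 -lt0n bin_gt0; lia.
apply: (LSp_block b_gt0 q_gt0 cardU leq_bin_block cE c'E W0U) => //.
- by apply: convex_LSp; elim: (j) => [|k IHk]; [exact: convex_bMT|exact: convex_LSp].
- by apply: IH => //; lia.
- move=> p pB; apply: IH.
  + exact: valid_block vF pB.
  + by rewrite (card_block_compl pB); lia.
  + by rewrite (card_block_compl pB).
Qed.

End Survival.

(** * An inequality separating the uniform point from the integer hull *)

Section IntegerHull.
Context {R : realType} {V : finType}.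
Variables (b q : nat).
Hypothesis q_ndvd : ~~ (q %| b * #|V|).

Local Open Scope ring_scope.

Lemma bMT_total (x : 'cV[R]_#|@qsets V q|) : bMT b (qsets q) x ->
  q%:R * \sum_j x j 0 <= (b * #|V|)%:R.
Proof.
move=> [_ xb]; rewrite mulnC natrM.
have -> : q%:R * \sum_j x j 0 =
    \sum_(i : V) \sum_(j | i \in (enum_val j : {set V})) x j 0.
  rewrite (exchange_big_dep xpredT) //= mulr_sumr; apply: eq_bigr => j _.
  rewrite sumr_const mulr_natl; congr (_ *+ _).
  by have := enum_valP j; rewrite inE => /eqP.
by rewrite mulr_natl -sumr_const; apply: ler_sum => i _; exact: xb.
Qed.

(** At a 0/1 point [q] times the total is a multiple of [q] and [b * #|V|] is not, so the bound of
    [bMT_total] is missed by at least 1. This passes to convex combinations. *)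
Lemma integer_hull_bMT_total (x : 'cV[R]_#|@qsets V q|) :
  integer_hull (bMT b (qsets q)) x -> q%:R * \sum_j x j 0 + 1 <= (b * #|V|)%:R.
Proof.
move: x; apply: classical_sets.smallest_sub.
  apply/convex_setP => x y t t0 t1 /= xH yH.
  under eq_bigr do rewrite !mxE.
  rewrite big_split /= -!mulr_sumr; nra.
move=> x [xP x01] /=; have := bMT_total xP.
have -> : \sum_j x j 0 = #|[set j | x j 0 == 1]|%:R.
  rewrite -sum1dep_card natr_sum [RHS]big_mkcond /=; apply: eq_bigr => j _.
  by case: (x01 j) => ->; rewrite ?eqxx // eq_sym oner_eq0.
rewrite -natrM natr1 !ler_nat leq_eqVlt => /orP[/eqP qE|//].
by move: q_ndvd; rewrite -qE dvdn_mulr.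
Qed.

End IntegerHull.

Theorem theorem4p7 (R : realType) (b p q : nat)
    (b_gt0 : 0 < b) (p_gt0 : 0 < p) (q_gt0 : 0 < q)
    (q_ndvd : ~~ (q %| b * p)) (le_b_q2 : b <= q ^ 2)
    (le_p : b + q - 1 <= p) :
  (p - (b + q - 1)) %/ (2 * q) + 1
    <= LSp_rank (@bMT R _ b (complete_hypergraph p q)).
Proof.
have q_gt1 : 1 < q.
  by rewrite ltn_neqAle q_gt0 andbT; apply: contraNneq q_ndvd => <-; rewrite dvd1n.
have bq : (b, q) != (4, 2).
  by apply: contraNneq q_ndvd => -[-> ->]; rewrite dvdn_mulr.
have [rankE _] := LSp_rankP (@convex_bMT R _ b (complete_hypergraph p q))
  (@bMT_cube R _ b (complete_hypergraph p q)).
set k := LSp_rank _ in rankE *.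
(* With a smaller rank [k] the uniform point would survive [k] rounds and lie in the integer hull,
   although [q] times its total weight is exactly [b * p]. *)
rewrite addn1 ltnNge; apply/negP => k_le.
have le_k : b + q - 1 + 2 * q * k <= p.
  by rewrite leq_divRL in k_le; lia.
have cp : #|[set: 'I_p]| = p by rewrite cardsT card_ord.
pose c : R := (b%:R / 'C(p.-1, q.-1)%:R)%R.
have cE : (c * 'C(p.-1, q.-1)%:R = b%:R)%R.
  by rewrite /c divfK // pnatr_eq0 -lt0n bin_gt0; lia.
have v0 : valid b q set0 [set: 'I_p].
  split=> [T|i]; first by rewrite inE.
  by rewrite eq_card0 // => T; rewrite !inE.
have := @LSp_iter_ext R _ b q b_gt0 q_gt1 le_b_q2 bq k [set: 'I_p] _ c v0.
rewrite cp => /(_ le_k cE); rewrite rankE => /integer_hull_bMT_total.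
rewrite card_ord => /(_ q_ndvd).
under eq_bigr do rewrite evec_mxE /ext inE subsetT.
rewrite sumr_const card_ord /qsets card_draws card_ord -[(c *+ _)%R]mulr_natr mulrCA -natrM.
have := mul_bin_diag p q.-1; rewrite (prednK q_gt0) => <-.
rewrite natrM mulrCA cE -natrM mulnC.
by rewrite gerDl ler10.
Qed.
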